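(* Let $f(w)=w+w^2+O(w^3)$ be a holomorphic germ at the origin of $\mathbb{C}$. Let $(\sigma_k)_{k\ge0}$ be a sequence of uniformly bounded complex-valued random variables such that $$\frac1n\sum_{k=0}^{n-1}\sigma_k\to u\in\mathbb{C}\quad\text{almost surely.}$$ For $n\ge1$ and $0\le k\le n-1$ let $$\varepsilon_{k,n}=\frac{\pi}{n}+\frac{\pi}{n^2}\sigma_k+O\Big(\frac{1}{n^{2+\alpha}}\Big)$$ for some $0<\alpha<1$ (with the $O$ uniform in $k$ and in the random outcome). For $w_0\in\mathcal{B}_f$ set $w_0^{(n)}=w_0$ and $w_{k+1}^{(n)}=f(w_k^{(n)})+\varepsilon_{k,n}^2$ for $0\le k\le n-1$. Then, for every $w_0\in\mathcal{B}_f$, the sequence of random variables $(w_n^{(n)})_n$ converges to $L_u(w_0)$ almost surely.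
   Context: Write $f(w)=w+w^2+aw^3+O(w^4)$. For sufficiently small $r>0$ let $P^\iota=\{|w+r|<r\}$ (attracting petal) and $P^o=\{|w-r|<r\}$ (repelling petal). $P^\iota$ is forward invariant under $f$ and $f^m(w)\to0$ for $w\in P^\iota$. The parabolic basin is $\mathcal{B}_f=\bigcup_{m\ge0}f^{-m}(P^\iota)$. Let $\log$ be the principal branch. The attracting and repelling Fatou coordinates are the (univalent, for $r$ small) holomorphic maps $\phi^\iota:P^\iota\to\mathbb{C}$, $\phi^o:P^o\to\mathbb{C}$ with $\phi^\iota(f(w))=\phi^\iota(w)+1$ and $\phi^o(f(w))=\phi^o(w)+1$ (the latter when $w,f(w)\in P^o$), normalized by $\phi^\iota(w)=-\frac1w+(1-a)\log(-w)+o(1)$ and $\phi^o(w)=-\frac1w+(1-a)\log w+o(1)$ as $w\to0$ in the respective petal. The map $\phi^\iota$ is extended to $\mathcal{B}_f$ by $\phi^\iota(w)=\phi^\iota(f^m(w))-m$ ($m$ large). The inverse $(\phi^o)^{-1}$, defined on a left half-plane, is extended to $\mathbb{C}$ by $(\phi^o)^{-1}(\zeta)=f^m\big((\phi^o)^{-1}(\zeta-m)\big)$ ($m$ large). For $u\in\mathbb{C}$ the Lavaurs map of phase $u$ is $L_u=(\phi^o)^{-1}\circ T_u\circ\phi^\iota$ on $\mathcal{B}_f$, where $T_u(\zeta)=\zeta+u$. Convention: $f$ is understood to be defined on a domain for which these extensions make sense (as is automatic, for instance, if $f$ is entire). *)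

(* Defs.v *)
From HB Require Import structures.
From mathcomp Require Import all_boot all_order all_algebra.
From mathcomp Require Import complex.
From mathcomp Require Import all_classical all_reals all_analysis.
Set Implicit Arguments.
Unset Strict Implicit.
Unset Printing Implicit Defensive.
Import Order.TTheory GRing.Theory Num.Theory.
Import numFieldNormedType.Exports.
Local Open Scope classical_set_scope.
Local Open Scope ring_scope.
Local Open Scope complex_scope.

(* The complex plane is R[i]^o: the alias ^o is what carries the topology and
   the structure of normed space over R[i] itself, so that [derivable _ w 1] is
   complex differentiability at w. Norms are valued in R[i]. *)

Section complex_plane.
Variable R : realType.
Local Notation C := (R[i]^o).

Definition holomorphic_on (U : set C) (f : C -> C) :=
  forall w, U w -> derivable f w 1.

(* Principal determination, with values in ]-pi, pi] for z != 0. *)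
Definition cArg (z : C) : R :=
  let t := acos (complex.Re z / complex.Re `|z|) in
  if 0 <= complex.Im z then t else - t.

Definition cLog (z : C) : C := Complex (ln (complex.Re `|z|)) (cArg z).

Definition borelC := g_sigma_algebraType (@open C).

End complex_plane.

Section parabolic.
Variable R : realType.
Local Notation C := (R[i]^o).

Definition attracting_petal (r : R) : set C := [set w | `|w + r%:C| < r%:C].

Definition repelling_petal (r : R) : set C := [set w | `|w - r%:C| < r%:C].

(* A map defined on U is a total function whose values outside U are
   irrelevant; f^m is defined at w when w, ..., f^(m-1)(w) lie in U. *)
Definition iter_defined (U : set C) (f : C -> C) (m : nat) (w : C) :=
  forall j, (j < m)%N -> U (iter j f w).

Definition parabolic_basin (U : set C) (f : C -> C) (r : R) : set C :=
  [set w | exists m, iter_defined U f m w /\ attracting_petal r (iter m f w)].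

Definition attracting_Fatou_coordinate (f : C -> C) (a : C) (r : R)
    (phi : C -> C) :=
  [/\ holomorphic_on (attracting_petal r) phi,
      {in attracting_petal r &, injective phi},
      forall w, attracting_petal r w -> phi (f w) = phi w + 1 &
      (fun w => phi w - (- w^-1 + (1 - a) * cLog (- w)))
        @ within (attracting_petal r) (nbhs (0 : C)) --> (0 : C)].

Definition repelling_Fatou_coordinate (f : C -> C) (a : C) (r : R)
    (phi : C -> C) :=
  [/\ holomorphic_on (repelling_petal r) phi,
      {in repelling_petal r &, injective phi},
      forall w, repelling_petal r w -> repelling_petal r (f w) ->
        phi (f w) = phi w + 1 &
      (fun w => phi w - (- w^-1 + (1 - a) * cLog w))
        @ within (repelling_petal r) (nbhs (0 : C)) --> (0 : C)].

(* In the two extensions below, the set under xget has at most one element,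
   namely the value taken for all large m. *)
Definition attracting_Fatou_ext (f : C -> C) (r : R) (phi : C -> C) (w : C) : C :=
  xget 0 [set z | \forall m \near \oo,
    attracting_petal r (iter m f w) /\ z = phi (iter m f w) - m%:R].

Definition repelling_inverse (r : R) (phi : C -> C) (zeta : C) : C :=
  xget 0 [set v | repelling_petal r v /\ phi v = zeta].

Definition repelling_inverse_ext (f : C -> C) (r : R) (phi : C -> C)
    (zeta : C) : C :=
  xget 0 [set z | \forall m \near \oo,
    z = iter m f (repelling_inverse r phi (zeta - m%:R))].

(* The convention on the domain U of f: the formula defining
   repelling_inverse_ext at zeta makes sense for all large m. Nothing of the
   kind is needed on the attracting side, where orbits of points of
   parabolic_basin stay in U by definition. *)
Definition repelling_inverse_extends (U : set C) (f : C -> C) (r : R)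
    (phi : C -> C) :=
  forall zeta : C, \forall m \near \oo,
    (phi @` repelling_petal r) (zeta - m%:R) /\
    iter_defined U f m (repelling_inverse r phi (zeta - m%:R)).

Definition Lavaurs_map (f : C -> C) (r : R) (phi_i phi_o : C -> C) (u w : C) : C :=
  repelling_inverse_ext f r phi_o (attracting_Fatou_ext f r phi_i w + u).

Fixpoint perturbed_orbit (f : C -> C) (e : nat -> C) (w0 : C) (k : nat) : C :=
  if k is k'.+1 then f (perturbed_orbit f e w0 k') + e k' ^+ 2 else w0.

End parabolic.

(* Main.v *)
(**
Write e = pi/n. Since [w |-> w + w^2 + e^2] is, up to terms of order three, the
Moebius map [-e cot(x) |-> -e cot(x + e)], an orbit crossing the gate is written
[w_k = -e cot(e k + y_k)] with [tan y_k = e c_k]: this is exact and needs no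
complex arctangent. Near the entrance [c_k] is close to [-1/w_k - k], near the
exit to [n - k - 1/w_k], and one step changes it by
[sin(e k)^2 (eps_k^2 - e^2) / e^2] plus a term which is odd under [k |-> n - k]
plus O((1 + |c_k|) / min(k, n-k)^2). The odd term sums to almost zero, so the
logarithms of the two Fatou coordinates cancel; the first term is nearly
[(2/n) sigma_k sin(e k)^2] and its sum tends to u by summation by parts.

On the repelling side, fix an ultrafilter of indices n. The limits x_m of
w_(n-m) form a backward orbit of f tending to 0, whose repelling Fatou coordinate
is phi_i(w_0) + u - m up to o(1) as m grows, hence exactly. Injectivity of phi_o
identifies x_m with the inverse branch used in the definition of the Lavaurs map,
so no continuity of that inverse is required.
*)

Require Import Defs.
From HB Require Import structures.
From mathcomp Require Import all_boot all_order all_algebra.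
From mathcomp Require Import complex.
From mathcomp Require Import all_classical all_reals all_analysis.
From mathcomp Require Import ring lra zify.
Set Implicit Arguments.
Unset Strict Implicit.
Unset Printing Implicit Defensive.
Import Order.TTheory GRing.Theory Num.Theory.
Import numFieldNormedType.Exports.
Local Open Scope classical_set_scope.
Local Open Scope ring_scope.
Local Open Scope complex_scope.

(** * The modulus as a real number *)

Section modulus.
Variable R : rcfType.
Implicit Types x y z : R[i].
Local Notation N := (@Normc.normc R).

(** The width [m] of the two ends stays fixed while [n] tends to infinity, and [m] grows last. For
    fixed [m] the estimate across the gate has an error [O(1 / sqrt m)], uniform in [n], which does
    not vanish: [w_(n-m)] is located only approximately and need not be known to converge. An
    ultrafilter provides limits for all [m] at once, and the functional equation on the resulting
    backward orbit turns the approximate position into an exact one.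

    Inside the gate the difficulty is circular: one step is controlled only while
    [(1 + |c_k|) / min(k, n-k)] is small, whereas the bound on [c_k] comes from adding up the
    earlier steps. The circle is closed by letting [|c_k|] grow like the square root of
    [min(k, n-k)]. The step errors are then [O(min(k, n-k)^(-3/2))], and their sum over
    [m <= k < n - m] is [O(1 / sqrt m)].

    The argument is deterministic: one outcome is fixed, and what is known about it is the bound on
    [sigma], the limit of its means and the expansion of [eps]. *)

Lemma cmodE z : `|z| = (N z)%:C.
Proof. by case: z. Qed.

Lemma cmod_ge0 z : 0 <= N z.
Proof. by case: z => ? ? /=; apply: sqrtr_ge0. Qed.

Lemma cmodM x y : N (x * y) = N x * N y.
Proof. exact: Normc.normcM. Qed.

Lemma cmodV x : N x^-1 = (N x)^-1.
Proof. exact: Normc.normcV. Qed.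

Lemma cmod_triangle x y : N (x + y) <= N x + N y.
Proof. exact: le_normcD. Qed.

Lemma cmodN x : N (- x) = N x.
Proof. exact: normcN. Qed.

Lemma cmod_triangleB x y : N (x - y) <= N x + N y.
Proof. by rewrite -(cmodN y); apply: cmod_triangle. Qed.

Lemma cmod_distC x y : N (x - y) = N (y - x).
Proof. by rewrite -cmodN opprB. Qed.

Lemma cmod_real (x : R) : N x%:C = `|x|.
Proof. by rewrite /= expr0n /= addr0 sqrtr_sqr. Qed.

Lemma cmod1 : N 1 = 1.
Proof. exact: Normc.normc1. Qed.

Lemma cmod0 : N 0 = 0.
Proof. exact: Normc.normc0. Qed.

Lemma cmodX x n : N (x ^+ n) = N x ^+ n.
Proof. by elim: n => [|n IH]; rewrite ?expr0 ?cmod1 // !exprS cmodM IH. Qed.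

Lemma cmod_eq0 x : (N x == 0) = (x == 0).
Proof. by apply/eqP/eqP => [/Normc.eq0_normc|->]; rewrite ?cmod0. Qed.

Lemma cmod_gt0 x : (0 < N x) = (x != 0).
Proof. by rewrite lt0r cmod_eq0 cmod_ge0 andbT. Qed.

Lemma cmodB_ge x y : N x - N y <= N (x - y).
Proof. by have := cmod_triangle (x - y) y; rewrite subrK; lra. Qed.

Lemma cmodD_ge x y : N x - N y <= N (x + y).
Proof. by have := cmodB_ge x (- y); rewrite cmodN opprK. Qed.

Lemma cmod_ge_Re z : `|complex.Re z| <= N z.
Proof. by have := normc_ge_Re z; rewrite cmodE lecR. Qed.

Lemma le_cmodM x y (s t : R) : N x <= s -> N y <= t -> N (x * y) <= s * t.
Proof. by move=> xs yt; rewrite cmodM ler_pM ?cmod_ge0. Qed.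

Lemma le_cmodD x y (s t : R) : N x <= s -> N y <= t -> N (x + y) <= s + t.
Proof. by move=> xs yt; apply: le_trans (cmod_triangle _ _) _; apply: lerD. Qed.

Lemma le_cmodB x y (s t : R) : N x <= s -> N y <= t -> N (x - y) <= s + t.
Proof. by move=> xs yt; apply: le_trans (cmod_triangleB _ _) _; apply: lerD. Qed.

Lemma le_cmodX x (s : R) n : N x <= s -> N (x ^+ n) <= s ^+ n.
Proof. by move=> xs; rewrite cmodX lerXn2r ?nnegrE ?cmod_ge0 // (le_trans _ xs) ?cmod_ge0. Qed.

Lemma le_cmodV x (s : R) : 0 < s -> s <= N x -> N x^-1 <= s^-1.
Proof. by move=> s0 sx; rewrite cmodV lef_pV2 ?posrE // (lt_le_trans s0 sx). Qed.

Lemma near1_ge x (s : R) : N (x - 1) <= s -> 1 - s <= N x.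
Proof.
by move=> h; have := cmodB_ge 1 (1 - x); rewrite subKr cmod1 (cmod_distC 1); lra.
Qed.

Lemma near1_le x (s : R) : N (x - 1) <= s -> N x <= 1 + s.
Proof. by move=> h; have := cmod_triangle (x - 1) 1; rewrite cmod1 subrK; lra. Qed.

Lemma near1_neq0 x (s : R) : N (x - 1) <= s -> s < 1 -> x != 0.
Proof. by move=> /near1_ge h s1; rewrite -cmod_gt0; lra. Qed.

Lemma near1M x y (s t : R) : N (x - 1) <= s -> N (y - 1) <= t ->
  N (x * y - 1) <= s + t + s * t.
Proof.
move=> xs yt.
rewrite (_ : x * y - 1 = (x - 1) + (y - 1) + (x - 1) * (y - 1)); last by ring.
by apply: le_cmodD; [apply: le_cmodD | apply: le_cmodM].
Qed.

Lemma near1V x (s : R) : N (x - 1) <= s -> s <= 2^-1 -> N (x^-1 - 1) <= 2 * s.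
Proof.
move=> xs s2.
have x0 : x != 0 by apply: near1_neq0 xs _; lra.
rewrite (_ : x^-1 - 1 = x^-1 * (1 - x)); last by rewrite mulrBr mulVf // mulr1.
rewrite -[2]invrK; apply: le_cmodM; last by rewrite cmod_distC.
by apply: le_cmodV; rewrite ?invr_gt0 ?ltr0n //; have := near1_ge xs; lra.
Qed.

End modulus.

(** * One step through the gate *)

Section frame.
Variable F : fieldType.
Implicit Types e h k c w : F.

(* For [h = e cot x], [frame_pt e h c] is [-e cot(x + y)] where [tan y = e c], and
   [frame_coord e h] is its inverse. For [k = tan(e)/e], [gate_rot e k] sends
   [-e cot z] to [-e cot(z + e)] and [cot_step e k] sends [e cot x] to
   [e cot(x + e)]. *)
Definition frame_pt e h c : F := (e ^+ 2 * c - h) / (1 + c * h).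
Definition frame_coord e h w : F := (w + h) / (e ^+ 2 - w * h).
Definition gate_rot e k w : F := (w + e ^+ 2 * k) / (1 - k * w).
Definition cot_step e k h : F := (h - k * e ^+ 2) / (1 + k * h).

Lemma frame_ptK e h w : e ^+ 2 - w * h != 0 -> e ^+ 2 + h ^+ 2 != 0 ->
  w = frame_pt e h (frame_coord e h w).
Proof.
move=> d0 p0; rewrite /frame_pt /frame_coord.
have -> : 1 + (w + h) / (e ^+ 2 - w * h) * h
  = (e ^+ 2 + h ^+ 2) / (e ^+ 2 - w * h) by field.
have -> : e ^+ 2 * ((w + h) / (e ^+ 2 - w * h)) - h
  = w * (e ^+ 2 + h ^+ 2) / (e ^+ 2 - w * h) by field.
by field; rewrite p0 d0.
Qed.

Lemma frame_pt_denom e h c : 1 + c * h != 0 ->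
  e ^+ 2 - frame_pt e h c * h = (e ^+ 2 + h ^+ 2) / (1 + c * h).
Proof. by move=> ch0; rewrite /frame_pt; field. Qed.

Lemma frame_coordK e h c : 1 + c * h != 0 -> e ^+ 2 + h ^+ 2 != 0 ->
  frame_coord e h (frame_pt e h c) = c.
Proof.
move=> ch0 p0; rewrite /frame_coord frame_pt_denom //.
have -> : frame_pt e h c + h = c * (e ^+ 2 + h ^+ 2) / (1 + c * h).
  by rewrite /frame_pt; field.
by field; rewrite p0 ch0.
Qed.

Lemma frame_coordB e h w1 w2 : e ^+ 2 - w1 * h != 0 -> e ^+ 2 - w2 * h != 0 ->
  frame_coord e h w1 - frame_coord e h w2 =
  (w1 - w2) * (e ^+ 2 + h ^+ 2) / ((e ^+ 2 - w1 * h) * (e ^+ 2 - w2 * h)).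
Proof. by move=> w10 w20; rewrite /frame_coord; field; rewrite w10 w20. Qed.

(** Both sides are [-e cot(x + y + e)]: the angle [e] may be added to the point or to the frame. An
    exact rotation thus leaves [c] unchanged, and every increment of [c] comes from the discrepancy
    between the perturbed map and [gate_rot]. *)
Lemma gate_rot_frame e h k c : 1 + c * h != 0 -> 1 + k * h != 0 ->
  1 - k * frame_pt e h c != 0 -> 1 + c * cot_step e k h != 0 ->
  gate_rot e k (frame_pt e h c) = frame_pt e (cot_step e k h) c.
Proof.
move=> ch0 kh0; rewrite /gate_rot /frame_pt /cot_step.
set d := 1 - _ => d0; set d' := 1 + _ => d'0.
have dE : d * (1 + c * h) = 1 + c * h - k * (e ^+ 2 * c - h).
  by rewrite /d; field.
have d'E : d' * (1 + k * h) = 1 + c * h - k * (e ^+ 2 * c - h).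
  by rewrite /d'; field.
apply/eqP; rewrite eqr_div //; apply/eqP.
have -> : d' = d * (1 + c * h) / (1 + k * h) by rewrite dE -d'E; field.
field.
by rewrite kh0 ch0.
Qed.

Lemma cot_step_norm e k h : 1 + k * h != 0 ->
  e ^+ 2 + (cot_step e k h) ^+ 2 =
  (e ^+ 2 + h ^+ 2) * (1 + k ^+ 2 * e ^+ 2) / (1 + k * h) ^+ 2.
Proof. by move=> kh0; rewrite /cot_step; field. Qed.

(** In the rotated frame [gate_rot e k w] still has coordinate [c], so the increment is the
    difference of one Moebius map at two points that are [X] apart. The factor [1 - G] is the ratio
    of the two denominators in that difference. *)
Lemma frame_coord_step e h k c X (h' := cot_step e k h)
    (rp := e ^+ 2 + h' ^+ 2) (G := X * h' * (1 + c * h') / rp)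
    (w := frame_pt e h c) (w' := X + gate_rot e k w) :
  1 + c * h != 0 -> 1 + k * h != 0 -> 1 - k * w != 0 ->
  1 + c * h' != 0 -> rp != 0 -> 1 - G != 0 ->
  e ^+ 2 - w' * h' != 0 /\
  frame_coord e h' w' - c = X * (1 + c * h') ^+ 2 / (rp * (1 - G)).
Proof.
move=> ch0 kh0 kw0 ch'0 rp0 G0.
have rotE : gate_rot e k w = frame_pt e h' c by apply: gate_rot_frame.
have d0 : e ^+ 2 - gate_rot e k w * h' = rp / (1 + c * h').
  by rewrite rotE frame_pt_denom.
have d'0 : e ^+ 2 - w' * h' = rp * (1 - G) / (1 + c * h').
  by rewrite mulrDl opprD addrCA d0 /G; field; rewrite rp0 ch'0.
have dn0 : e ^+ 2 - w' * h' != 0.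
  by rewrite d'0 mulf_neq0 ?invr_neq0 // mulf_neq0.
split=> //.
rewrite -[c in LHS](frame_coordK ch'0 rp0) -rotE frame_coordB //; last first.
  by rewrite d0 mulf_neq0 ?invr_neq0.
by rewrite -/rp d0 d'0 /w' addrK; field; rewrite rp0 G0 ch'0.
Qed.
End frame.

(** * Estimates for one perturbed step in the rotating frame *)

Section gate_step.
Variable R : rcfType.
Implicit Types a e h k c w X : R[i].
Implicit Types A E K rho : R.
Local Notation N := (@Normc.normc R).

Lemma cmod_nat n : N n%:R = n%:R.
Proof. by rewrite -(rmorph_nat (real_complex R)) cmod_real normr_nat. Qed.

(** Here [rho] is [e / sin x], which dominates [e] and [h], and [|c| * rho] is the relative size of
    every correction: [w] is close to [-h], and [w ^+ 2 + e ^+ 2] is close to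
    [h ^+ 2 + e ^+ 2 = rho ^+ 2]. *)
Lemma frame_pt_bound e h c rho : 0 < rho -> N e <= rho -> N h <= rho ->
  e ^+ 2 + h ^+ 2 = (rho ^+ 2)%:C -> (1 + N c) * rho <= 1 / 64 ->
  let w := frame_pt e h c in
  [/\ N (c * h) <= N c * rho, N (w + h) <= 2 * (N c * rho ^+ 2),
      N w <= 2 * rho &
      N ((w ^+ 2 + e ^+ 2) / (rho ^+ 2)%:C - 1) <= 4 * (N c * rho)].
Proof.
move=> rho0 eR hR erho cR w.
have Nc0 := cmod_ge0 c.
have [x [xE x0 x64 rho64]] : exists x, [/\ x = N c * rho, 0 <= x,
    x <= 1 / 64 & rho <= 1 / 64].
  exists (N c * rho); have : 0 <= N c * rho by rewrite mulr_ge0 // ltW.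
  by clear -cR Nc0 rho0; split => //; nra.
have chx : N (c * h) <= x by rewrite xE; apply: le_cmodM.
have ch : N (1 + c * h - 1) <= x by rewrite addrC addKr.
have ch0 : 1 + c * h != 0 by apply: near1_neq0 ch _; clear -x64; lra.
have chN : 9 / 10 <= N (1 + c * h).
  by have := near1_ge ch; clear -x64; lra.
have wh : N (w + h) <= 2 * (N c * rho ^+ 2).
  rewrite (_ : w + h = (1 + c * h)^-1 * (c * (e ^+ 2 + h ^+ 2))); last first.
    by rewrite /w /frame_pt; field.
  apply: le_cmodM.
    rewrite -[2]invrK; apply: le_cmodV; first by rewrite invr_gt0.
    by clear -chN; lra.
  by apply: le_cmodM => //; rewrite erho cmod_real ger0_norm ?sqr_ge0.
have xrho : N c * rho ^+ 2 = x * rho by rewrite xE; ring.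
rewrite -xE; split=> //.
  have := cmodB_ge w (- h); rewrite cmodN opprK.
  by move: wh hR; rewrite xrho; clear -x64 rho0; nra.
have -> : (w ^+ 2 + e ^+ 2) / (rho ^+ 2)%:C - 1 =
    ((e * c) ^+ 2 - 2 * (c * h) - (c * h) ^+ 2) * ((1 + c * h) ^+ 2)^-1.
  rewrite -erho /w /frame_pt; field; rewrite ch0 erho -cmod_eq0 cmod_real.
  by rewrite normr_eq0 expf_neq0 // gt_eqF.
apply: (@le_trans _ _ ((x ^+ 2 + 2 * x + x ^+ 2) * ((9 / 10) ^+ 2)^-1)).
  apply: le_cmodM.
    apply: le_cmodB; last exact: le_cmodX.
    apply: le_cmodB; first by apply: le_cmodX; rewrite mulrC xE; apply: le_cmodM.
    by apply: le_cmodM; rewrite ?(cmod_nat 2).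
  apply: le_cmodV; first by clear; lra.
  by rewrite cmodX lerXn2r ?nnegrE ?cmod_ge0 //; clear; lra.
rewrite ler_pdivrMr; last by clear; lra.
by clear -x0 x64; nra.
Qed.

(** The rotation fixes the two roots of [w ^+ 2 + e ^+ 2], so this factor splits off the error; the
    cofactor is also of order [rho ^+ 2] because [k - 1] is. The cubic term [w * (w ^+ 2 + e ^+ 2)]
    kept here is what turns [a] into [a - 1] in the drift, and so matches the coefficient of the
    logarithm in the Fatou coordinates. *)
Lemma gate_rot_expansion e k w rho : 0 < rho -> N e <= rho -> N w <= 2 * rho ->
  N (k - 1) <= rho ^+ 2 -> rho <= 1 / 64 ->
  1 - k * w != 0 /\
  N (gate_rot e k w - (w + (w ^+ 2 + e ^+ 2) * (1 + w))) <= 100 * rho ^+ 4.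
Proof.
move=> rho0 eR wR kR rho64.
have kN : N k <= 2 by have := near1_le kR; clear -rho0 rho64; nra.
have kw : N (1 - k * w - 1) <= 4 * rho.
  rewrite (_ : 1 - k * w - 1 = - (k * w)); last by ring.
  rewrite cmodN (_ : 4 * rho = 2 * (2 * rho)); last by ring.
  exact: le_cmodM.
have kw0 : 1 - k * w != 0 by apply: near1_neq0 kw _; clear -rho64; lra.
split=> //.
have -> : gate_rot e k w - (w + (w ^+ 2 + e ^+ 2) * (1 + w)) =
   (w ^+ 2 + e ^+ 2) * ((k - 1) * (1 + w) + k * w ^+ 2) / (1 - k * w).
  by rewrite /gate_rot; field.
rewrite (_ : 100 * rho ^+ 4 =
   (((2 * rho) ^+ 2 + rho ^+ 2) * (rho ^+ 2 * 2 + 2 * (2 * rho) ^+ 2)) * 2); last by ring.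
apply: le_cmodM; last first.
  rewrite -[2]invrK; apply: le_cmodV; first by rewrite invr_gt0.
  by have := near1_ge kw; clear -rho64; lra.
apply: le_cmodM; first by apply: le_cmodD; apply: le_cmodX.
apply: le_cmodD; apply: le_cmodM => //; last exact: le_cmodX.
by apply: le_trans (cmod_triangle _ _) _; rewrite cmod1; move: wR; clear -rho64; lra.
Qed.

Lemma cot_step_bound e h k c rho : 0 < rho -> N e <= rho -> N h <= rho ->
  e ^+ 2 + h ^+ 2 = (rho ^+ 2)%:C -> N (k - 1) <= rho ^+ 2 ->
  (1 + N c) * rho <= 1 / 64 ->
  let h' := cot_step e k h in
  [/\ N (1 + k * h - 1) <= 2 * rho, N (1 + k ^+ 2 * e ^+ 2 - 1) <= rho / 2,
      N h' <= 2 * rho, N (1 + c * h' - 1) <= 2 * (N c * rho) &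
      e ^+ 2 + h' ^+ 2 != 0 /\
      N ((e ^+ 2 + h' ^+ 2)^-1) <= 2 * (rho ^+ 2)^-1].
Proof.
move=> rho0 eR hR erho kR cR h'.
have Nc0 := cmod_ge0 c.
have rho64 : rho <= 1 / 64 by clear -cR Nc0 rho0; nra.
have kN : N k <= 2 by have := near1_le kR; clear -rho0 rho64; nra.
have kh : N (1 + k * h - 1) <= 2 * rho.
  by rewrite addrC addKr; apply: le_cmodM.
have kh0 : 1 + k * h != 0 by apply: near1_neq0 kh _; clear -rho64; lra.
have k2e : N (1 + k ^+ 2 * e ^+ 2 - 1) <= rho / 2.
  rewrite addrC addKr; apply: (@le_trans _ _ (2 ^+ 2 * rho ^+ 2)).
    by apply: le_cmodM; apply: le_cmodX.
  by clear -rho0 rho64; nra.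
have k2e0 : 1 + k ^+ 2 * e ^+ 2 != 0.
  by apply: near1_neq0 k2e _; clear -rho64; lra.
have h'R : N h' <= 2 * rho.
  apply: (@le_trans _ _ ((rho + 2 * rho ^+ 2) * (10 / 9))).
    apply: le_cmodM; first by apply: le_cmodB => //; apply: le_cmodM => //; apply: le_cmodX.
    rewrite -[10 / 9]invrK; apply: le_cmodV; first by rewrite invr_gt0; clear; lra.
    by have := near1_ge kh; clear -rho64; lra.
  by clear -rho0 rho64; nra.
have rN : N (rho ^+ 2)%:C = rho ^+ 2 by rewrite cmod_real ger0_norm ?sqr_ge0.
have r2 : (rho ^+ 2)%:C != 0 :> R[i] by rewrite -cmod_eq0 rN expf_neq0 // gt_eqF.
split=> //.
  rewrite addrC addKr (_ : 2 * _ = N c * (2 * rho)); last by ring.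
  exact: le_cmodM.
rewrite cot_step_norm // erho; split.
  by rewrite mulf_neq0 ?invr_neq0 ?expf_neq0 // mulf_neq0.
rewrite -mulrA invfM mulrC; apply: le_cmodM; last by rewrite cmodV rN.
rewrite invf_div cmodM.
apply: (@le_trans _ _ ((1 + 2 * rho) ^+ 2 * (9 / 10)^-1)).
  apply: ler_pM; rewrite ?cmod_ge0 //.
    by apply: le_cmodX; exact: near1_le kh.
  apply: le_cmodV; first by clear; lra.
  by have := near1_ge k2e; clear -rho64; lra.
rewrite ler_pdivrMr; last by clear; lra.
by clear -rho0 rho64; nra.
Qed.

(* The factor by which the exact increment of [frame_coord] differs from
   [X / rho^2] in [gate_step]. *)
Lemma near1_gate_factor (x1 x2 x3 x4 : R[i]) (rho x : R) :
  0 < rho -> 0 <= x -> rho + x <= 1 / 64 ->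
  N (x1 - 1) <= 2 * rho -> N (x2 - 1) <= 2 * x -> N (x3 - 1) <= rho / 2 ->
  N (x4 - 1) <= rho / 2 ->
  N (x1 * x1 * (x2 * x2) * (x3^-1 * x4^-1) - 1) <= 16 * (rho + x).
Proof.
move=> rho0 x0 g64 h1 h2 h3 h4.
have n1 : N (x1 * x1 - 1) <= 5 * (rho + x).
  by apply: le_trans (near1M h1 h1) _; clear -rho0 x0 g64; nra.
have n2 : N (x2 * x2 - 1) <= 5 * (rho + x).
  by apply: le_trans (near1M h2 h2) _; clear -rho0 x0 g64; nra.
have r2 : rho / 2 <= 2^-1 by clear -x0 g64; lra.
have n3 : N (x3^-1 * x4^-1 - 1) <= 3 * (rho + x).
  apply: le_trans (near1M (near1V h3 r2) (near1V h4 r2)) _.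
  by clear -rho0 x0 g64; nra.
apply: le_trans (near1M (near1M n1 n2) n3) _.
by clear -rho0 x0 g64; nra.
Qed.

(** Leading part of the increment of [c]: the discrepancy [eta + (a - 1) w (w^2 + e^2) - a e^2 w],
    evaluated at [w = -h] and [w^2 + e^2 = rho^2], divided by [rho^2]. *)
Definition gate_drift a e h eta rho : R[i] :=
  eta / (rho ^+ 2)%:C - (a - 1) * h + a * e ^+ 2 * h / (rho ^+ 2)%:C.

Lemma gate_step_drift K A E : 0 <= K -> 0 <= A -> 0 <= E ->
  exists C : R, 0 <= C /\
  forall a e h k c eta fw rho (w := frame_pt e h c)
    (X := fw + e ^+ 2 + eta - gate_rot e k w),
  N a <= A -> 0 < rho -> N e <= rho -> N h <= rho ->
  e ^+ 2 + h ^+ 2 = (rho ^+ 2)%:C -> N (k - 1) <= rho ^+ 2 ->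
  (1 + N c) * rho <= 1 / 64 -> N eta <= E * rho ^+ 3 ->
  N (fw - (w + w ^+ 2 + a * w ^+ 3)) <= K * N w ^+ 4 ->
  N X <= C * rho ^+ 3 /\
  N (X / (rho ^+ 2)%:C - gate_drift a e h eta rho) <= C * (1 + N c) * rho ^+ 2.
Proof.
move=> K0 A0 E0.
(* The 16 is [2 ^ 4], from [N w <= 2 * rho] in the Taylor remainder of [f]; the 100 comes from
   [gate_rot_expansion]. *)
pose C0 := 16 * K + 100.
exists (E + 10 * (A + 1) + 2 * A + C0); split; first by clear -K0 A0 E0; rewrite /C0; lra.
move=> a e h k c eta fw rho w X aA rho0 eR hR erho kR cR etaR fE.
have [_ wh wR Dnear] := frame_pt_bound rho0 eR hR erho cR.
have Nc0 := cmod_ge0 c.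
have rho64 : rho <= 1 / 64 by clear -cR Nc0 rho0; nra.
have [kw0 rotE] := gate_rot_expansion rho0 eR wR kR rho64.
rewrite -/w in wh wR Dnear kw0 rotE.
set D := w ^+ 2 + e ^+ 2 in Dnear rotE.
pose Er := (fw - (w + w ^+ 2 + a * w ^+ 3)) - (gate_rot e k w - (w + D * (1 + w))).
have ErR : N Er <= C0 * rho ^+ 4.
  rewrite (_ : C0 * rho ^+ 4 = K * (2 * rho) ^+ 4 + 100 * rho ^+ 4); last first.
    by rewrite /C0; ring.
  apply: le_cmodB rotE; apply: le_trans fE _.
  by rewrite ler_wpM2l // lerXn2r // nnegrE ?cmod_ge0 // mulr_ge0 // ltW.
(* The cubic term of [f] is rewritten with [w^3 = w (w^2 + e^2) - e^2 w], so that it combines with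
   that of the rotation. *)
have XE : X = eta + (a - 1) * w * D - a * e ^+ 2 * w + Er.
  by rewrite /X /Er /D; ring.
have a1 : N (a - 1) <= A + 1 by apply: le_cmodB; rewrite ?cmod1.
have rN : N (rho ^+ 2)%:C = rho ^+ 2 by rewrite cmod_real ger0_norm ?sqr_ge0.
have rho2 : rho ^+ 2 != 0 by rewrite expf_neq0 // gt_eqF.
have r2 : (rho ^+ 2)%:C != 0 :> R[i] by rewrite -cmod_eq0 rN.
have r2N : N ((rho ^+ 2)%:C)^-1 = (rho ^+ 2)^-1 by rewrite cmodV rN.
have C00 : 0 <= C0 by rewrite /C0; clear -K0; lra.
split.
  apply: (@le_trans _ _ (E * rho ^+ 3 + (A + 1) * (2 * rho) * (5 * rho ^+ 2)
     + A * rho ^+ 2 * (2 * rho) + C0 * rho ^+ 4)).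
    rewrite XE; apply: le_cmodD => //.
    apply: le_cmodB; last by apply: le_cmodM => //; apply: le_cmodM => //; apply: le_cmodX.
    apply: le_cmodD => //; apply: le_cmodM; first exact: le_cmodM.
    rewrite (_ : 5 * _ = (2 * rho) ^+ 2 + rho ^+ 2); last by ring.
    by apply: le_cmodD; apply: le_cmodX.
  rewrite -subr_ge0 (_ : _ - _ = C0 * (rho ^+ 3 * (1 - rho))); last by ring.
  by rewrite !mulr_ge0 ?exprn_ge0 ?subr_ge0 // ?ltW //; clear -rho64; lra.
have -> : X / (rho ^+ 2)%:C - gate_drift a e h eta rho =
   (a - 1) * (w * (D / (rho ^+ 2)%:C - 1) + (w + h))
    - a * e ^+ 2 * (w + h) * ((rho ^+ 2)%:C)^-1 + Er / (rho ^+ 2)%:C.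
  by rewrite /gate_drift XE; move: ((rho ^+ 2)%:C) r2 => r r0; field.
apply: (@le_trans _ _ ((A + 1) * ((2 * rho) * (4 * (N c * rho)) + 2 * (N c * rho ^+ 2))
    + A * rho ^+ 2 * (2 * (N c * rho ^+ 2)) * (rho ^+ 2)^-1
    + C0 * rho ^+ 4 * (rho ^+ 2)^-1)).
  apply: le_cmodD; last by apply: le_cmodM => //; rewrite r2N.
  apply: le_cmodB.
    by apply: le_cmodM => //; apply: le_cmodD => //; apply: le_cmodM.
  apply: le_cmodM; last by rewrite r2N.
  by apply: le_cmodM => //; apply: le_cmodM => //; apply: le_cmodX.
rewrite -subr_ge0 (_ : _ - _ = rho ^+ 2 * (E * (1 + N c) + (10 * (A + 1) + 2 * A)
    + C0 * N c)); last by field; rewrite gt_eqF.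
by rewrite mulr_ge0 ?sqr_ge0 // !addr_ge0 // ?mulr_ge0 // ?addr_ge0.
Qed.

(** The exact increment is [X / rho^2] times a factor [Phi] within [16 * (rho + |c| * rho)] of 1.
    Since [X / rho^2] is [O(rho)], dropping [Phi] costs [O((1 + |c|) rho^2)], the same order as
    replacing [X / rho^2] by the drift. *)
Lemma gate_step K A E : 0 <= K -> 0 <= A -> 0 <= E ->
  exists C th : R, [/\ 0 <= C, 0 < th <= 1 / 64 &
  forall a e h k c eta fw rho,
  let w := frame_pt e h c in
  let h' := cot_step e k h in
  let w' := fw + e ^+ 2 + eta in
  let c' := frame_coord e h' w' in
  N a <= A -> 0 < rho -> N e <= rho -> N h <= rho ->
  e ^+ 2 + h ^+ 2 = (rho ^+ 2)%:C -> N (k - 1) <= rho ^+ 2 ->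
  (1 + N c) * rho <= th -> N eta <= E * rho ^+ 3 ->
  N (fw - (w + w ^+ 2 + a * w ^+ 3)) <= K * N w ^+ 4 ->
  w' = frame_pt e h' c' /\
  N (c' - c - gate_drift a e h eta rho) <= C * (1 + N c) * rho ^+ 2].
Proof.
move=> K0 A0 E0.
have [C1 [C10 driftP]] := gate_step_drift K0 A0 E0.
(* The threshold keeps both [rho] and [C1 * rho] below [1 / 64], which makes [G] at most [rho / 2]
   and the division by [1 - G] harmless. *)
exists (C1 + 16 * C1), (64 * (1 + C1))^-1; split.
- by clear -C10; lra.
- rewrite invr_gt0; apply/andP; split; first by clear -C10; lra.
  by rewrite div1r lef_pV2 ?posrE; clear -C10; lra.
move=> a e h k c eta fw rho w h' w' c' aA rho0 eR hR erho kR cth etaR fE.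
have [th64 C1th] : (64 * (1 + C1))^-1 <= 1 / 64 /\ C1 * (64 * (1 + C1))^-1 <= 1 / 64.
  have C64 : 0 < 64 * (1 + C1) by clear -C10; lra.
  by split; rewrite -[X in X <= _]mul1r ?mulrA ler_pdivrMr //; clear -C10; lra.
have cR : (1 + N c) * rho <= 1 / 64 by apply: le_trans cth th64.
have C1rho : C1 * rho <= 1 / 64.
  apply: le_trans C1th; rewrite ler_wpM2l //; apply: le_trans cth.
  by rewrite ler_peMl ?lerDl ?cmod_ge0 // ltW.
have [XR drift] := driftP _ _ _ _ _ _ _ _ aA rho0 eR hR erho kR cR etaR fE.
have [ch _ wR _] := frame_pt_bound rho0 eR hR erho cR.
have Nc0 := cmod_ge0 c.
have [x [xE x0 g64]] : exists x, [/\ x = N c * rho, 0 <= x &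
    rho + x <= 1 / 64].
  exists (N c * rho); have : 0 <= N c * rho by rewrite mulr_ge0 // ltW.
  by clear -cR; split => //; move: cR; rewrite mulrDl mul1r.
have rho64 : rho <= 1 / 64 by clear -g64 x0; lra.
have [kw0 _] := gate_rot_expansion rho0 eR wR kR rho64.
have [kh k2e h'R ch' [rp0 rpV]] := cot_step_bound rho0 eR hR erho kR cR.
rewrite -/w -/h' in kw0 wR drift XR h'R ch' rp0 rpV; rewrite -xE in ch ch'.
have ch0 : 1 + c * h != 0.
  by apply: (@near1_neq0 _ _ x); rewrite ?(addrC 1) ?addrK //; clear -g64 rho0; lra.
have kh0 : 1 + k * h != 0 by apply: near1_neq0 kh _; clear -rho64; lra.
have ch'0 : 1 + c * h' != 0 by apply: near1_neq0 ch' _; clear -g64 rho0 x0; lra.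
have k2e0 : 1 + k ^+ 2 * e ^+ 2 != 0.
  by apply: near1_neq0 k2e _; clear -rho64; lra.
set X := _ - gate_rot e k w in XR drift.
have w'E : w' = X + gate_rot e k w by rewrite /X subrK.
set rp := e ^+ 2 + h' ^+ 2 in rp0 rpV.
pose G := X * h' * (1 + c * h') / rp.
have rN : N (rho ^+ 2)%:C = rho ^+ 2 by rewrite cmod_real ger0_norm ?sqr_ge0.
have rhoN0 : rho != 0 by rewrite gt_eqF.
have r2 : (rho ^+ 2)%:C != 0 :> R[i] by rewrite -cmod_eq0 rN expf_neq0.
have GR : N (1 - G - 1) <= rho / 2.
  have -> : 1 - G - 1 = - G by ring.
  rewrite cmodN.
  apply: (@le_trans _ _ (C1 * rho ^+ 3 * (2 * rho) * 2 * (2 * (rho ^+ 2)^-1))).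
    apply: le_cmodM => //; apply: le_cmodM; first exact: le_cmodM.
    by have := near1_le ch'; clear -g64 rho0 x0; lra.
  have -> : C1 * rho ^+ 3 * (2 * rho) * 2 * (2 * (rho ^+ 2)^-1)
     = 8 * (C1 * rho) * rho by field.
  by clear -C1rho rho0; nra.
have G0 : 1 - G != 0 by apply: near1_neq0 GR _; clear -rho64; lra.
have [d0 stepE] := frame_coord_step ch0 kh0 kw0 ch'0 rp0 G0.
rewrite -/w -w'E in d0 stepE; split; first exact: frame_ptK.
pose Phi := (1 + k * h) * (1 + k * h) * ((1 + c * h') * (1 + c * h')) *
   ((1 + k ^+ 2 * e ^+ 2)^-1 * (1 - G)^-1).
have c'c : c' - c = X / (rho ^+ 2)%:C * Phi.
  rewrite stepE -/h' -/rp -/G {1}/rp cot_step_norm // erho /Phi.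
  move: ((rho ^+ 2)%:C) r2 => r r0.
  by field; rewrite G0 exprMn k2e0 r0 kh0.
have PhiN := near1_gate_factor rho0 x0 g64 kh ch' k2e GR.
rewrite -/Phi in PhiN.
have -> : c' - c - gate_drift a e h eta rho =
    (X / (rho ^+ 2)%:C - gate_drift a e h eta rho) + X / (rho ^+ 2)%:C * (Phi - 1).
  by rewrite c'c; ring.
rewrite (_ : (C1 + 16 * C1) * (1 + N c) * rho ^+ 2 = C1 * (1 + N c) * rho ^+ 2
  + C1 * rho ^+ 3 * (rho ^+ 2)^-1 * (16 * (rho + x))); last by rewrite xE; field.
apply: le_cmodD => //.
by apply: le_cmodM => //; apply: le_cmodM => //; rewrite cmodV rN.
Qed.
End gate_step.

(** * Trigonometric data of the gate *)

Section trigonometry.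
Variable R : realType.
Implicit Types x y : R.

Lemma sin_MVT x : 0 < x -> exists2 y, 0 < y < x & sin x = x * cos y.
Proof.
move=> x0; have [y yx] : exists2 y, y \in `]0, x[ & sin x - sin 0 = cos y * (x - 0).
  apply: (@MVT R sin cos 0 x x0).
  by apply: continuous_subspaceT; apply: continuous_sin.
by rewrite in_itv /= in yx; rewrite sin0 !subr0 mulrC => ->; exists y.
Qed.

Lemma sin_le x : 0 <= x -> sin x <= x.
Proof.
rewrite le_eqVlt => /orP[/eqP<-|x0]; first by rewrite sin0.
have [y _ ->] := sin_MVT x0; rewrite ger_pMr //; exact: cos_le1.
Qed.

Lemma norm_sin_le x : `|sin x| <= `|x|.
Proof.
have H y : 0 <= y -> `|sin y| <= y.
  move=> y0; have := sin_le y0; have [y1|y1] := lerP y 1.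
    have : 0 <= sin y.
      by apply: sin_ge0_pi; rewrite y0 /= (le_trans y1) // (le_trans _ (pi_ge2 R)) // ler1n.
    by move=> ? ?; rewrite ger0_norm.
  by move=> _; apply: le_trans (sin_max y) _; apply: ltW.
have [x0|x0] := leP 0 x; first by rewrite (ger0_norm x0) H.
by rewrite -normrN -sinN (ltr0_norm x0) H // oppr_ge0 ltW.
Qed.

Lemma cos_ge x : 1 - x ^+ 2 / 2 <= cos x.
Proof.
have -> : x = (x / 2) *+ 2 by rewrite mulr2n; field.
rewrite cos_mulr2n; set t := x / 2.
have := norm_sin_le t; rewrite -ler_sqr ?nnegrE // !real_normK ?num_real //.
rewrite sin2cos2 mulr2n; lra.
Qed.

Lemma sin_ge x : 0 <= x <= pi / 2 -> x / 4 <= sin x.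
Proof.
move=> /andP[x0 xpi].
have xlt2 : x < 2 by apply: le_lt_trans xpi (pihalf_lt2 R).
have small y : 0 <= y <= 1 -> y / 2 <= sin y.
  move=> /andP[]; rewrite le_eqVlt => /orP[/eqP<-|y0 y1]; first by rewrite sin0 mul0r.
  have [z /andP[z0 zy] ->] := sin_MVT y0; rewrite ler_pM2l //.
  have := cos_ge z; nra.
have [x1|x1] := leP x 1; first by have := small x; lra.
have : sin 1 <= sin x.
  have pih1 := pihalf_ge1 R; have pi0 := pi_gt0 R.
  by rewrite le_eqVlt ltr_sin ?x1 ?orbT // in_itv /=; lra.
have := small 1; lra.
Qed.

(** By [sin_MVT], [sin x = x cos y] for some [y] below [x]; both [tan(e) / e] and [x cot x] thereby
    become quotients of two cosines. *)
Lemma cos_ratio x y : 0 <= x <= 1 -> 0 <= y <= 1 -> x <= y ->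
  `|cos x / cos y - 1| <= y ^+ 2 /\ `|cos y / cos x - 1| <= y ^+ 2.
Proof.
move=> x01 y01 xy.
have hx := cos_ge x; have hy := cos_ge y.
have lx := cos_le1 x; have ly := cos_le1 y.
have cx : 1 / 2 <= cos x by nra.
have cy : 1 / 2 <= cos y by nra.
have xy2 : x ^+ 2 <= y ^+ 2 by nra.
have y2 : y ^+ 2 <= 1 by nra.
have n1 u v : 1/2 <= u <= 1 -> 1/2 <= v <= 1 -> 1 - y ^+ 2 / 2 <= u -> 1 - y ^+ 2 / 2 <= v ->
    `|u / v - 1| <= y ^+ 2.
  move=> hu hv uy vy.
  rewrite (_ : u / v - 1 = (u - v) / v); last by field; lra.
  rewrite normrM normfV (@gtr0_norm _ v); last by lra.
  rewrite ler_pdivrMr; last by lra.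
  rewrite ler_norml; nra.
by split; apply: n1; lra.
Qed.

Lemma sin_lipschitz x y : `|sin x - sin y| <= `|x - y|.
Proof.
have -> : sin x - sin y = cos ((x + y) / 2) * sin ((x - y) / 2) *+ 2.
  set p := (x + y) / 2; set q := (x - y) / 2.
  have -> : sin x = sin (p + q) by congr sin; rewrite /p /q; field.
  have -> : sin y = sin (p - q) by congr sin; rewrite /p /q; field.
  by rewrite sinD sinB mulr2n; ring.
rewrite -mulr_natr !normrM normr_nat.
have := cos_max ((x + y) / 2); have := norm_sin_le ((x - y) / 2).
rewrite normrM (@ger0_norm _ 2^-1) ?invr_ge0 ?ler0n //.
have := normr_ge0 (x - y); have := normr_ge0 (sin ((x - y) / 2)).
have := normr_ge0 (cos ((x + y) / 2)).
move: `|cos _| `|sin _| `|x - y| => p q s; nra.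
Qed.
End trigonometry.

(** * The real frame along the gate and its symmetry under [k |-> n - k] *)

Section gate_data.
Variable R : realType.
Local Notation N := (@Normc.normc R).

(* Meaningful for [0 < k < n]; at [k = 0] the division by zero gives [0]. *)
Definition gate_eps (n : nat) : R := pi / n%:R.
Definition gate_cot (n k : nat) : R :=
  gate_eps n * cos (gate_eps n * k%:R) / sin (gate_eps n * k%:R).
Definition gate_rho (n k : nat) : R := gate_eps n / sin (gate_eps n * k%:R).
Definition gate_kappa (n : nat) : R :=
  sin (gate_eps n) / (gate_eps n * cos (gate_eps n)).

Lemma gate_eps_gt0 n : (0 < n)%N -> 0 < gate_eps n.
Proof. by move=> n0; rewrite divr_gt0 ?pi_gt0 // ltr0n. Qed.

Lemma gate_epsn n : (0 < n)%N -> gate_eps n * n%:R = pi.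
Proof. by move=> n0; rewrite /gate_eps divfK // pnatr_eq0 -lt0n. Qed.

Lemma gate_sin_gt0 n k : (0 < k < n)%N -> 0 < sin (gate_eps n * k%:R).
Proof.
move=> /andP[k0 kn]; have n0 : (0 < n)%N by apply: leq_trans kn.
apply: sin_gt0_pi; rewrite mulr_gt0 ?gate_eps_gt0 ?ltr0n //=.
by rewrite -[ltRHS](gate_epsn n0) ltr_pM2l ?gate_eps_gt0 // ltr_nat.
Qed.

Lemma gate_rho_gt0 n k : (0 < k < n)%N -> 0 < gate_rho n k.
Proof.
by move=> kn; rewrite divr_gt0 ?gate_sin_gt0 // gate_eps_gt0 //; lia.
Qed.

Lemma gate_rhoE n k : (0 < k < n)%N ->
  gate_eps n ^+ 2 + gate_cot n k ^+ 2 = gate_rho n k ^+ 2.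
Proof.
move=> kn; have /lt0r_neq0 s0 := gate_sin_gt0 kn.
have := cos2Dsin2 (gate_eps n * k%:R).
rewrite /gate_cot /gate_rho; move: (cos _) (sin _) s0 => c s s0 cs.
move: (gate_eps n) => e.
have -> : (e / s) ^+ 2 = e ^+ 2 * (c ^+ 2 + s ^+ 2) / s ^+ 2 by rewrite cs; field.
by field.
Qed.

Lemma gate_eps_le_rho n k : (0 < k < n)%N -> gate_eps n <= gate_rho n k.
Proof.
move=> kn; rewrite ler_pdivlMr ?gate_sin_gt0 // ger_pMr ?sin_le1 //.
by rewrite gate_eps_gt0 //; lia.
Qed.

Lemma gate_cot_le_rho n k : (0 < k < n)%N -> `|gate_cot n k| <= gate_rho n k.
Proof.
move=> kn; have r0 := gate_rho_gt0 kn.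
rewrite -ler_sqr ?nnegrE ?(ltW r0) // real_normK ?num_real // -gate_rhoE //.
by rewrite lerDr sqr_ge0.
Qed.

Lemma gate_sin_rev n k : (k <= n)%N -> (0 < n)%N ->
  sin (gate_eps n * (n - k)%:R) = sin (gate_eps n * k%:R).
Proof.
move=> kn n0; rewrite natrB // mulrBr gate_epsn // sinB sinpi cospi.
by rewrite mul0r sub0r mulN1r opprK.
Qed.

Lemma gate_cos_rev n k : (k <= n)%N -> (0 < n)%N ->
  cos (gate_eps n * (n - k)%:R) = - cos (gate_eps n * k%:R).
Proof.
move=> kn n0; rewrite natrB // mulrBr gate_epsn // cosB sinpi cospi.
by rewrite mul0r addr0 mulN1r.
Qed.

Lemma gate_rho_rev n k : (k <= n)%N -> (0 < n)%N ->
  gate_rho n (n - k) = gate_rho n k.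
Proof. by move=> kn n0; rewrite /gate_rho gate_sin_rev. Qed.

Lemma gate_cot_rev n k : (k <= n)%N -> (0 < n)%N ->
  gate_cot n (n - k) = - gate_cot n k.
Proof.
by move=> kn n0; rewrite /gate_cot gate_sin_rev // gate_cos_rev // mulrN mulNr.
Qed.

Lemma gate_rho_le_half n k : (0 < k)%N -> (k.*2 <= n)%N ->
  gate_rho n k <= 4 / k%:R.
Proof.
move=> k0 kn; have n0 : (0 < n)%N by lia.
have e0 := gate_eps_gt0 n0.
rewrite ler_pdivlMr ?ltr0n // mulrAC ler_pdivrMr; last by apply: gate_sin_gt0; lia.
have : gate_eps n * k%:R / 4 <= sin (gate_eps n * k%:R).
  apply: sin_ge; rewrite mulr_ge0 ?(ltW e0) //=.
  rewrite ler_pdivlMr // -mulrA -[leRHS](gate_epsn n0) ler_pM2l //.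
  by rewrite -natrM ler_nat; lia.
by lra.
Qed.

Lemma gate_rho_le n k : (0 < k < n)%N ->
  gate_rho n k <= 4 / (minn k (n - k))%:R.
Proof.
move=> kn; have [kle|kgt] := leqP k (n - k).
  by apply: gate_rho_le_half; lia.
by rewrite -gate_rho_rev ?gate_rho_le_half //; lia.
Qed.

Lemma gate_cot_step n k : (2 < n)%N -> (0 < k)%N -> (k.+1 < n)%N ->
  gate_cot n k.+1 = (gate_cot n k - gate_kappa n * gate_eps n ^+ 2)
     / (1 + gate_kappa n * gate_cot n k).
Proof.
move=> n2 k0 kn; have e0 : 0 < gate_eps n by apply: gate_eps_gt0; lia.
have c0 : 0 < cos (gate_eps n).
  apply: cos_gt0_pihalf; have := pi_gt0 R => pi0; apply/andP; split; first by lra.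
  by rewrite /gate_eps ltr_pM2l // ltf_pV2 ?posrE ?ltr0n //; [rewrite ltr_nat | lia].
have s0 : 0 < sin (gate_eps n * k%:R) by apply: gate_sin_gt0; lia.
have s1 : 0 < sin (gate_eps n * k.+1%:R) by apply: gate_sin_gt0; lia.
rewrite /gate_cot /gate_kappa.
have -> : k.+1%:R = k%:R + 1 :> R by rewrite -natr1.
have : sin (gate_eps n * (k%:R + 1)) != 0 by rewrite natr1 gt_eqF.
rewrite mulrDr mulr1 sinD cosD.
have := lt0r_neq0 c0; have := lt0r_neq0 s0; have := lt0r_neq0 e0.
move: (gate_eps n) (sin _) (cos _) (cos _) (sin _) => e s c' c s' e_0 s_0 c_0 d0.
field.
rewrite e_0 s_0 c_0 /=.
by apply: contra_neq d0 => <-; ring.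
Qed.

Lemma gate_kappa_near1 n : (3 < n)%N -> `|gate_kappa n - 1| <= gate_eps n ^+ 2.
Proof.
move=> n4; have e0 : 0 < gate_eps n by apply: gate_eps_gt0; lia.
have e1 : gate_eps n <= 1.
  rewrite /gate_eps ler_pdivrMr ?ltr0n; last by lia.
  have := pihalf_lt2 R; have : 4 <= n%:R :> R by rewrite ler_nat.
  by lra.
have [y /andP[y0 ye] sE] := sin_MVT e0.
rewrite /gate_kappa sE -mulf_div divff ?gt_eqF // mul1r.
by apply: (cos_ratio _ _ _).1; lra.
Qed.

Lemma gate_cot_asympt n k : (0 < k)%N -> gate_eps n * k%:R <= 1 -> (0 < n)%N ->
  `|k%:R * gate_cot n k - 1| <= (gate_eps n * k%:R) ^+ 2.
Proof.
move=> k0 x1 n0; set x := gate_eps n * _ in x1 *.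
have x0 : 0 < x by rewrite mulr_gt0 ?gate_eps_gt0 ?ltr0n.
have [y /andP[y0 yx] sE] := sin_MVT x0.
have -> : k%:R * gate_cot n k = cos x / cos y.
  have cy : cos y != 0 by rewrite gt_eqF //; have := cos_ge y; clear -y0 yx x1; nra.
  rewrite /gate_cot -/x sE; move: (cos x) (cos y) cy => cx c c0; rewrite /x.
  by field; rewrite c0 !gt_eqF ?ltr0n ?gate_eps_gt0.
by apply: (cos_ratio _ _ _).2; lra.
Qed.

(** Gives the weights [(2/n) sin(e k)^2] total mass 1, which is why the averaged perturbation tends
    to [u] itself. The cosines of the doubled angles add up to zero because [2 sin(e) cos(2 e k)]
    telescopes over a full period. *)
Lemma sum_sin2 n : (1 < n)%N ->
  \sum_(0 <= k < n) sin (gate_eps n * k%:R) ^+ 2 = n%:R / 2.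
Proof.
move=> n1; have n0 : (0 < n)%N by lia.
set e := gate_eps n; have e0 : 0 < e by exact: gate_eps_gt0.
have se : 0 < sin e by have := @gate_sin_gt0 n 1; rewrite mulr1; apply.
pose F k := sin (e * ((k%:R *+ 2) - 1)).
have tele k : 2 * sin e * cos ((e * k%:R) *+ 2) = F k.+1 - F k.
  rewrite /F.
  have -> : e * (k.+1%:R *+ 2 - 1) = (e * k%:R) *+ 2 + e.
    by rewrite -[k.+1%:R]natr1 !mulr2n; ring.
  have -> : e * (k%:R *+ 2 - 1) = (e * k%:R) *+ 2 - e by rewrite !mulr2n; ring.
  by rewrite sinD sinB; ring.
have sum0 : \sum_(0 <= k < n) cos ((e * k%:R) *+ 2) = 0.
  apply: (@mulfI _ (2 * sin e)); first by rewrite mulf_neq0 ?gt_eqF.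
  rewrite mulr0 big_distrr /= (eq_bigr (fun k => F k.+1 - F k)) => [|k _]; last exact: tele.
  rewrite telescope_sumr // /F.
  have -> : e * (n%:R *+ 2 - 1) = pi *+ 2 - e.
    by rewrite -(gate_epsn n0) -/e !mulr2n; ring.
  have -> : e * (0%:R *+ 2 - 1) = - e by rewrite mul0rn sub0r mulrN1.
  by rewrite sinB sin2pi cos2pi sinN; ring.
rewrite (eq_bigr (fun k => 2^-1 - 2^-1 * cos ((e * k%:R) *+ 2))); last first.
  by move=> k _; rewrite cos_mulr2n sin2cos2 !mulr2n; field.
by rewrite sumrB -big_distrr /= sum0 mulr0 subr0 sumr_const_nat subn0 -[LHS]mulr_natl.
Qed.
End gate_data.

(** * Sums along the gate *)

Section sums.
Variable R : realType.
Local Notation N := (@Normc.normc R).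

(** This is [j^(-3/2)], the order of a step error [(1 + |c|) / j^2] when [|c|] is [O(sqrt j)]. *)
Definition root_weight (j : nat) : R := (j%:R * Num.sqrt j%:R)^-1.

Lemma sqrt_nat_ge1 (j : nat) : (0 < j)%N -> 1 <= Num.sqrt j%:R :> R.
Proof. by move=> j0; rewrite -[leLHS]sqrtr1 ler_wsqrtr // ler1n. Qed.

(** Replaces two consecutive square roots by real unknowns with polynomial relations, so that the
    comparisons below become polynomial inequalities. *)
Lemma sqrt_nat_succ (j : nat) : (0 < j)%N ->
  exists s t : R, [/\ s = Num.sqrt j%:R, t = Num.sqrt j.+1%:R, 1 <= s,
    s <= t & s ^+ 2 = j%:R /\ t ^+ 2 = s ^+ 2 + 1].
Proof.
move=> j0; exists (Num.sqrt j%:R), (Num.sqrt j.+1%:R); split => //.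
- exact: sqrt_nat_ge1.
- by rewrite ler_wsqrtr // ler_nat.
- by rewrite !sqr_sqrtr // -natr1.
Qed.

(* Square roots replace the logarithmic bound on harmonic sums: any growth
   [o(j)] whose quotient by [j^2] is summable would do. *)
Lemma inv_le_sqrtB (j : nat) : (0 < j)%N ->
  j%:R^-1 <= 4 * (Num.sqrt j.+1%:R - Num.sqrt j%:R) :> R.
Proof.
move=> /sqrt_nat_succ [s [t [<- <- s1 st [<- t2]]]].
have tE : t - s = (s + t)^-1.
  have st0 : s + t != 0 by rewrite gt_eqF //; lra.
  apply: (mulIf st0); rewrite mulVf // (_ : _ * _ = t ^+ 2 - s ^+ 2); last by ring.
  by rewrite t2; ring.
have t2s : t <= 2 * s by nra.
rewrite tE -[leLHS]mul1r ler_pdivrMr ?exprn_gt0 //; last by lra.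
rewrite mulrAC ler_pdivlMr; last by lra.
by nra.
Qed.

Lemma root_weight_le (j : nat) : (0 < j)%N ->
  root_weight j <= 4 * ((Num.sqrt j%:R)^-1 - (Num.sqrt j.+1%:R)^-1).
Proof.
rewrite /root_weight; move=> /sqrt_nat_succ [s [t [<- <- s1 st [<- t2]]]].
have tE : t - s = (s + t)^-1.
  have st0 : s + t != 0 by rewrite gt_eqF //; lra.
  apply: (mulIf st0); rewrite mulVf // (_ : _ * _ = t ^+ 2 - s ^+ 2); last by ring.
  by rewrite t2; ring.
have -> : s^-1 - t^-1 = (s + t)^-1 / (s * t) by rewrite -tE; field; rewrite !gt_eqF //; lra.
rewrite -invfM -[leLHS]mul1r ler_pdivrMr; last by rewrite -exprSr exprn_gt0 //; lra.
rewrite mulrAC ler_pdivlMr; last by rewrite !mulr_gt0 //; lra.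
rewrite -subr_ge0 (_ : _ - _ = s * (4 * s ^+ 2 - t * s - t ^+ 2)); last by ring.
by apply: mulr_ge0; nra.
Qed.

Lemma sum_inv_le (m k : nat) : (0 < m)%N ->
  \sum_(m <= j < k) j%:R^-1 <= 4 * Num.sqrt k%:R :> R.
Proof.
move=> m0; have [mk|km] := leqP m k; last first.
  by rewrite big_geq ?mulr_ge0 ?sqrtr_ge0 // ltnW.
apply: (@le_trans _ _ (\sum_(m <= j < k) (4 * Num.sqrt j.+1%:R - 4 * Num.sqrt j%:R))).
  rewrite big_nat_cond [leRHS]big_nat_cond; apply: ler_sum => j.
  rewrite andbT => /andP[mj _].
  by rewrite -mulrBr inv_le_sqrtB // (leq_trans m0).
rewrite (telescope_sumr (fun j => 4 * Num.sqrt j%:R)) //.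
by rewrite lerBlDr lerDl mulr_ge0 // sqrtr_ge0.
Qed.

Lemma sum_root_weight_le (m k : nat) : (0 < m)%N ->
  \sum_(m <= j < k) root_weight j <= 4 / Num.sqrt m%:R.
Proof.
move=> m0; have [mk|km] := leqP m k; last first.
  by rewrite big_geq ?divr_ge0 ?sqrtr_ge0 // ltnW.
apply: (@le_trans _ _ (\sum_(m <= j < k) (- (4 / Num.sqrt j.+1%:R) - - (4 / Num.sqrt j%:R)))).
  rewrite big_nat_cond [leRHS]big_nat_cond; apply: ler_sum => j.
  rewrite andbT => /andP[mj _].
  by rewrite opprK addrC -mulrBr root_weight_le // (leq_trans m0).
rewrite (telescope_sumr (fun j => - (4 / Num.sqrt j%:R))) //.
by rewrite opprK addrC gerBl divr_ge0 // sqrtr_ge0.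
Qed.

Lemma root_weight_ge0 j : 0 <= root_weight j.
Proof. by rewrite invr_ge0 mulr_ge0 // sqrtr_ge0. Qed.

Lemma le_cmod_sum (m k : nat) (F : nat -> R[i]) (G : nat -> R) :
  (forall j, (m <= j < k)%N -> N (F j) <= G j) ->
  N (\sum_(m <= j < k) F j) <= \sum_(m <= j < k) G j.
Proof.
move=> FG; rewrite big_nat_cond [leRHS]big_nat_cond.
apply: (big_ind2 (fun x y => N x <= y)); first by rewrite cmod0.
  by move=> x1 x2 y1 y2; apply: le_cmodD.
by move=> j; rewrite andbT; apply: FG.
Qed.

Lemma sum_rev_nat (V : nmodType) (y : nat -> V) (m n : nat) :
  \sum_(m <= j < (n - m).+1) y (n - j)%N = \sum_(m <= j < (n - m).+1) y j.
Proof.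
rewrite [RHS]big_nat_rev /= big_nat_cond [RHS]big_nat_cond.
by apply: eq_bigr => j /andP[/andP[mj jn] _]; congr y; lia.
Qed.

(** * Sums of a sequence that is odd under [j |-> n - j] *)

Section odd_sum.
Variables (y : nat -> R[i]) (m n : nat) (Y : R).
Hypothesis y_odd : forall j, (m <= j <= n - m)%N -> y (n - j)%N = - y j.
Hypothesis y_le : forall j, (m <= j <= n - m)%N -> N (y j) <= Y / (minn j (n - j))%:R.
Hypothesis m_gt0 : (0 < m)%N.
Hypothesis Y_ge0 : 0 <= Y.

Lemma odd_sum_eq0 l : (m <= l)%N -> \sum_(l <= j < (n - l).+1) y j = 0.
Proof.
move=> ml; set S := LHS.
have : S = - S.
  rewrite -sumrN /S -[in LHS]sum_rev_nat big_nat_cond [RHS]big_nat_cond.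
  by apply: eq_bigr => j /andP[/andP[lj jn] _]; rewrite y_odd //; lia.
move/eqP; rewrite -addr_eq0 -mulr2n -mulr_natr mulf_eq0 pnatr_eq0 orbF.
by move/eqP.
Qed.

(** Since [j < k], the condition [k.*2 <= n.+2] still confines [j] to the first half, where the
    minimum is [j]. The slack is needed to apply the bound at [(n - k).+1] in [odd_sum_le]. *)
Lemma odd_sum_half k : (k <= (n - m).+1)%N -> (k.*2 <= n.+2)%N ->
  N (\sum_(m <= j < k) y j) <= 4 * Y * Num.sqrt k%:R.
Proof.
move=> kn k2; apply: (@le_trans _ _ (\sum_(m <= j < k) Y * j%:R^-1)).
  apply: le_cmod_sum => j /andP[mj jk].
  have := y_le (j := j); rewrite (minn_idPl _); last by lia.
  by apply; lia.
rewrite -big_distrr /= (mulrC 4) -mulrA ler_wpM2l //; exact: sum_inv_le.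
Qed.

(** Past the middle, the terms of index strictly between [n - k] and [k] cancel in pairs, and the
    partial sum falls back to the one ending at [n - k]. Hence the bound on [c_k] shrinks towards
    the exit as it grew from the entrance. *)
Lemma odd_sum_le k : (m <= k <= n - m)%N ->
  N (\sum_(m <= j < k) y j) <= 8 * Y * Num.sqrt (minn k (n - k))%:R.
Proof.
move=> /andP[mk kn]; have [kle|kgt] := leqP k (n - k).
  apply: (le_trans (odd_sum_half _ _)); [lia|lia|].
  by rewrite ler_wpM2r ?sqrtr_ge0 // ler_wpM2r // ler_nat.
rewrite (@big_cat_nat _ _ _ (n - k).+1) /=; [|lia|lia].
have -> : \sum_((n - k).+1 <= j < k) y j = 0.
  by have := @odd_sum_eq0 (n - k).+1; rewrite (_ : (n - (n - k).+1).+1 = k);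
    [apply; lia | lia].
rewrite addr0; apply: (le_trans (odd_sum_half _ _)); [lia|lia|].
have l0 : (0 < n - k)%N by lia.
have [s [t [<- <- s1 st [_ t2]]]] := sqrt_nat_succ l0.
rewrite (_ : 8 * Y * s = 4 * Y * (2 * s)); last by ring.
by rewrite ler_wpM2l ?mulr_ge0 //; nra.
Qed.

(** Only the index [m] has no partner in this range, as [n - m] is excluded; the sum is therefore
    minus the missing term. *)
Lemma odd_sum_total : (m.*2 <= n)%N -> N (\sum_(m <= j < n - m) y j) <= Y / m%:R.
Proof.
move=> mn; have := odd_sum_eq0 (leqnn m); rewrite big_nat_recr /=; last by lia.
move/eqP; rewrite addr_eq0 => /eqP ->; rewrite cmodN.
have := y_le (j := n - m); rewrite (minn_idPr _); last by lia.
by rewrite subKn; [apply; lia | lia].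
Qed.
End odd_sum.
End sums.

(** * Crossing the gate *)

Ltac nlia :=
  repeat match goal with
  | H : ?T |- _ =>
    lazymatch T with
    | nat => fail
    | is_true (leq _ _) => fail
    | is_true (andb (leq _ _) (leq _ _)) => fail
    | _ => clear H
    end
  end; lia.

Section gate_passage.
Variable R : realType.
Local Notation N := (@Normc.normc R).
Implicit Types (m n k : nat).

Definition gate_coord (n : nat) (w : nat -> R[i]) (k : nat) : R[i] :=
  frame_coord (gate_eps R n)%:C (gate_cot R n k)%:C (w k).

Lemma gate_frame_cast n k : (0 < k < n)%N ->
  [/\ N (gate_eps R n)%:C <= gate_rho R n k, N (gate_cot R n k)%:C <= gate_rho R n k &
    (gate_eps R n)%:C ^+ 2 + (gate_cot R n k)%:C ^+ 2 = (gate_rho R n k ^+ 2)%:C].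
Proof.
move=> kn; have n0 : (0 < n)%N by nlia.
rewrite !cmod_real gate_cot_le_rho // gtr0_norm ?gate_eps_gt0 // gate_eps_le_rho //.
by split=> //; rewrite -gate_rhoE // rmorphD !rmorphXn.
Qed.

Lemma gate_cot_step_cast n k : (2 < n)%N -> (0 < k)%N -> (k.+1 < n)%N ->
  cot_step (gate_eps R n)%:C (gate_kappa R n)%:C (gate_cot R n k)%:C
  = (gate_cot R n k.+1)%:C.
Proof.
move=> n2 k0 kn; rewrite gate_cot_step // /cot_step.
move: (gate_kappa R n) (gate_cot R n k) (gate_eps R n) => kp hc ep.
by rewrite [RHS]rmorphM fmorphV rmorphB rmorphD !rmorphM rmorph1.
Qed.

Lemma exists_sqrt_nat_ge (x : R) : exists m0 : nat, (0 < m0)%N /\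
  forall m, (m0 <= m)%N -> x <= Num.sqrt m%:R.
Proof.
exists (Num.truncn (x ^+ 2)).+1; split=> // m m0m.
have x2 : x ^+ 2 <= m%:R.
  apply/ltW; apply: lt_le_trans (truncnS_gt _) _; by rewrite ler_nat.
by rewrite (le_trans (ler_norm x)) // -sqrtr_sqr ler_wsqrtr.
Qed.

(** Bootstrap along [k]: the invariant [P k] gives [|c_k| <= B sqrt(mu k)] through [bound]; this
    bound validates [gate_step], whose error is then at most [D] times [root_weight] at [mu k], and
    [P k.+1] follows. The constants [C] and [m1] depend neither on [m] nor on [n], as the limits
    taken later require. *)
Lemma gate_passage (f : R[i] -> R[i]) (a : R[i]) (r1 K E A0 : R) :
  0 < r1 -> 0 <= K -> 0 <= E -> 0 <= A0 ->
  (forall w, N w < r1 -> N (f w - (w + w ^+ 2 + a * w ^+ 3)) <= K * N w ^+ 4) ->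
  exists (C : R) (m1 : nat), [/\ 0 <= C, (0 < m1)%N &
  forall m n (eta w : nat -> R[i]), (m1 <= m)%N -> (m.*2 < n)%N ->
  (forall k, (m <= k < n - m)%N -> N (eta k) <= E * gate_eps R n ^+ 3) ->
  (forall k, (m <= k < n - m)%N ->
     w k.+1 = f (w k) + (gate_eps R n)%:C ^+ 2 + eta k) ->
  (gate_eps R n)%:C ^+ 2 - w m * (gate_cot R n m)%:C != 0 ->
  N (gate_coord n w m) <= A0 * Num.sqrt m%:R ->
  [/\ N (gate_coord n w (n - m)) <= C * Num.sqrt m%:R,
    w (n - m)%N = frame_pt (gate_eps R n)%:C (gate_cot R n (n - m))%:C
                   (gate_coord n w (n - m)) &
    N (gate_coord n w (n - m) - gate_coord n w m
       - \sum_(m <= j < n - m) eta j / (gate_rho R n j ^+ 2)%:C)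
      <= C / Num.sqrt m%:R]].
Proof.
move=> r10 K0 E0 A00 fE.
have [C1 [th [C10 /andP[th0 th64] stepP]]] := gate_step K0 (cmod_ge0 a) E0.
have pi0 := pi_ge0 R; have Na0 := cmod_ge0 a.
(* The odd part of the drift is at most [(2 |a| + 1) rho], and [gate_rho_le] contributes the 4. *)
pose Y := 4 * (2 * N a + 1).
have Y0 : 0 <= Y by rewrite /Y; clear -Na0; lra.
(* Total effect of the perturbation: fewer than [n] terms, each at most [E * gate_eps R n], and [n]
   times [gate_eps R n] is [pi]. *)
pose S := E * pi; have S0 : 0 <= S by rewrite mulr_ge0.
(* The four summands bound, in this order, the entrance coordinate, the perturbation, the odd sum
   and the accumulated step errors. *)
pose B := A0 + S + 8 * Y + 1; have B1 : 1 <= B by rewrite /B; clear -A00 S0 Y0; lra.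
(* The 16 comes from [rho ^+ 2 <= (4 / mu) ^+ 2], and [1 + B] from
   [1 + |c_k| <= (1 + B) sqrt mu]. *)
pose D := 16 * C1 * (1 + B).
have D0 : 0 <= D by rewrite /D !mulr_ge0 //; clear -B1; lra.
(* The term [8 * D] keeps the accumulated error below 1, the second term gives the smallness
   required by [gate_step], [8 / r1] keeps [w k] in the disc of radius [r1], and 2 ensures
   [m >= 4]. *)
have [m1 [m10 m1P]] := exists_sqrt_nat_ge (8 * D + 4 * (1 + B) / th + 8 / r1 + 2).
exists (B + 8 * D + Y), m1; split=> //; first by clear -B1 D0 Y0; lra.
move=> m n eta w m1m mn etaE wS wm0 cmA.
have {}m1P := m1P m m1m; set sm := Num.sqrt m%:R in m1P cmA *.
have m0 : (0 < m)%N by nlia.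
have th4 : 0 < 4 * (1 + B) / th by rewrite divr_gt0 //; clear -B1; lra.
have r18 : 0 < 8 / r1 by rewrite divr_gt0.
have smD : 8 * D <= sm by clear -m1P th4 r18 D0; lra.
have smth : 4 * (1 + B) <= th * sm.
  by rewrite (mulrC th) -ler_pdivrMr //; clear -m1P th4 r18 D0; lra.
have smr : 8 < r1 * sm.
  by rewrite (mulrC r1) -ltr_pdivrMr //; clear -m1P th4 r18 D0; lra.
have sm2 : 2 <= sm by clear -m1P th4 r18 D0; lra.
have smm : sm ^+ 2 = m%:R by rewrite sqr_sqrtr.
have m4 : (4 <= m)%N.
  by rewrite -(ler_nat R) -smm; clear -sm2; nra.
have n0 : (0 < n)%N by nlia.
have e0 := @gate_eps_gt0 R n n0.
set e := (gate_eps R n)%:C in wS wm0 *.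
pose h k := (gate_cot R n k)%:C; pose rho k := gate_rho R n k.
pose c := gate_coord n w.
pose mu k := minn k (n - k).
pose q k := eta k / (rho k ^+ 2)%:C.
pose y k := - (a - 1) * h k + a * e ^+ 2 * h k / (rho k ^+ 2)%:C.
have y_odd j : (m <= j <= n - m)%N -> y (n - j)%N = - y j.
  move=> jm; rewrite /y /h /rho gate_cot_rev ?gate_rho_rev //; [|nlia|nlia].
  by rewrite rmorphN; ring.
have rho0 j : (m <= j <= n - m)%N -> 0 < rho j.
  by move=> jm; apply: gate_rho_gt0; nlia.
have rho_mu j : (m <= j <= n - m)%N -> rho j <= 4 / (mu j)%:R.
  by move=> jm; apply: gate_rho_le; nlia.
have castP j : (m <= j <= n - m)%N ->
    [/\ N e <= rho j, N (h j) <= rho j & e ^+ 2 + h j ^+ 2 = (rho j ^+ 2)%:C].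
  by move=> jm; apply: gate_frame_cast; nlia.
have Nr j : (m <= j <= n - m)%N -> N ((rho j ^+ 2)%:C)^-1 = (rho j ^+ 2)^-1.
  by move=> /rho0 r0; rewrite cmodV cmod_real gtr0_norm // exprn_gt0.
have y_le j : (m <= j <= n - m)%N -> N (y j) <= Y / (minn j (n - j))%:R.
  move=> jm; have r0 := rho0 _ jm; have [eR hR _] := castP _ jm.
  apply: (@le_trans _ _ ((2 * N a + 1) * rho j)).
    rewrite (_ : _ * rho j = (N a + 1) * rho j +
      N a * rho j ^+ 2 * rho j * (rho j ^+ 2)^-1); last by field; rewrite gt_eqF.
    apply: le_cmodD.
      by apply: le_cmodM => //; rewrite cmodN; apply: le_cmodB; rewrite ?cmod1.
    apply: le_cmodM; last by rewrite Nr.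
    by apply: le_cmodM => //; apply: le_cmodM => //; apply: le_cmodX.
  rewrite /Y (mulrC 4) -mulrA ler_wpM2l ?rho_mu //.
  by clear -Na0; lra.
have q_le j : (m <= j < n - m)%N -> N (q j) <= E * gate_eps R n.
  move=> jm; have jm' : (m <= j <= n - m)%N by nlia.
  have r0 := rho0 _ jm'; have [eR _ _] := castP _ jm'.
  rewrite cmod_real gtr0_norm // in eR.
  apply: (@le_trans _ _ (E * gate_eps R n ^+ 3 * (rho j ^+ 2)^-1)).
    by apply: le_cmodM; [apply: etaE | rewrite Nr].
  rewrite -mulrA ler_wpM2l // ler_pdivrMr ?exprn_gt0 //.
  by rewrite exprS ler_wpM2l ?(ltW e0) // lerXn2r // nnegrE ltW.
have sumq k : (m <= k <= n - m)%N -> N (\sum_(m <= j < k) q j) <= S.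
  move=> mk; apply: (@le_trans _ _ (\sum_(m <= j < k) (E * gate_eps R n))).
    by apply: le_cmod_sum => j jm; apply: q_le; nlia.
  rewrite sumr_const_nat -[leLHS]mulr_natr -mulrA ler_wpM2l //.
  by rewrite -[leRHS](gate_epsn R n0) ler_wpM2l ?(ltW e0) // ler_nat; nlia.
pose p k := root_weight R k.
have sump k : (m <= k <= n - m)%N -> \sum_(m <= j < k) (p j + p (n - j)%N) <= 8 / sm.
  move=> mk; rewrite big_split /= (_ : 8 / sm = 4 / sm + 4 / sm); last by ring.
  apply: lerD; first exact: sum_root_weight_le.
  apply: le_trans (sum_root_weight_le R (n - m).+1 m0).
  rewrite -sum_rev_nat (@big_cat_nat _ _ _ k m (n - m).+1) /=; [|nlia|nlia].
  by rewrite lerDl sumr_ge0 // => j _; apply: root_weight_ge0.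
(* The first half records that the frame coordinate really describes [w k], that is, that no
   denominator has vanished so far. *)
pose P k := w k = frame_pt e (h k) (c k) /\
  N (c k - c m - \sum_(m <= j < k) (q j + y j))
    <= D * \sum_(m <= j < k) (p j + p (n - j)%N).
have smV : sm^-1 <= 1 by rewrite invf_le1; [clear -sm2; lra | clear -sm2; lra].
have mu_ge j : (m <= j <= n - m)%N -> sm <= Num.sqrt (mu j)%:R.
  by move=> jm; rewrite ler_wsqrtr // ler_nat; rewrite /mu; nlia.
have bound k : (m <= k <= n - m)%N -> P k -> N (c k) <= B * Num.sqrt (mu k)%:R.
  move=> mk [_ Pk].
  have smk := mu_ge _ mk.
  have hy := odd_sum_le y_odd y_le m0 Y0 mk; rewrite -/(mu k) in hy.
  set s := Num.sqrt (mu k)%:R in smk hy *.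
  have -> : c k = (c k - c m - \sum_(m <= j < k) (q j + y j)) + c m
     + \sum_(m <= j < k) q j + \sum_(m <= j < k) y j.
    by rewrite big_split /=; ring.
  apply: (@le_trans _ _ (1 + A0 * sm + S + 8 * Y * s)).
    apply: le_cmodD => //; apply: le_cmodD; last exact: sumq.
    apply: le_cmodD => //; apply: le_trans Pk _.
    apply: (@le_trans _ _ (D * (8 / sm))); first by rewrite ler_wpM2l // sump.
    by rewrite mulrA ler_pdivrMr; [clear -smD; lra | clear -sm2; lra].
  have hA : A0 * sm <= A0 * s by rewrite ler_wpM2l.
  have hS : S <= S * s by rewrite ler_peMr //; clear -smk sm2; lra.
  by rewrite /B !mulrDl; clear -hA hS smk sm2; lra.
have step k : (m <= k < n - m)%N -> P k -> P k.+1.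
  move=> mk Pk; have mk' : (m <= k <= n - m)%N by nlia.
  have ck := bound _ mk' Pk; have smk := mu_ge _ mk'.
  case: Pk => wk ck'; have r0 := rho0 _ mk'; have [eR hR erho] := castP _ mk'.
  have rmu := rho_mu _ mk'.
  have muE : Num.sqrt (mu k)%:R ^+ 2 = (mu k)%:R :> R by rewrite sqr_sqrtr.
  set s := Num.sqrt (mu k)%:R in smk ck muE.
  have s0 : 0 < s by clear -smk sm2; lra.
  have rs : rho k * s <= 4 / s.
    rewrite -muE in rmu; apply: le_trans (_ : 4 / s ^+ 2 * s <= _).
      by rewrite ler_wpM2r // ltW.
    by rewrite (_ : 4 / s ^+ 2 * s = 4 / s) //; field; rewrite gt_eqF.
  have ckB : 1 + N (c k) <= (1 + B) * s.
    by rewrite mulrDl mul1r; clear -ck smk sm2; lra.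
  have ckth : (1 + N (c k)) * rho k <= th.
    apply: (@le_trans _ _ ((1 + B) * s * rho k)); first by rewrite ler_wpM2r // ltW.
    apply: (@le_trans _ _ ((1 + B) * (4 / s))).
      by rewrite -mulrA (mulrC s) ler_wpM2l //; clear -B1; lra.
    rewrite mulrA ler_pdivrMr // (mulrC _ 4); apply: le_trans smth _.
    by rewrite ler_wpM2l // ltW.
  have kap : N ((gate_kappa R n)%:C - 1) <= rho k ^+ 2.
    rewrite -(rmorph1 (real_complex R)) -rmorphB cmod_real.
    apply: le_trans (@gate_kappa_near1 R n _) _; first by nlia.
    rewrite cmod_real gtr0_norm // in eR.
    by rewrite lerXn2r // nnegrE ltW.
  have etak : N (eta k) <= E * rho k ^+ 3.
    apply: le_trans (etaE _ mk) _; rewrite ler_wpM2l //.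
    rewrite cmod_real gtr0_norm // in eR.
    by rewrite lerXn2r // nnegrE ltW.
  have rs4 : rho k * s <= 4.
    apply: le_trans rs _; rewrite ler_pdivrMr //.
    by clear -smk sm2; lra.
  have [_ _ wR _] := frame_pt_bound r0 eR hR erho (le_trans ckth th64).
  rewrite -wk in wR.
  have wr1 : N (w k) < r1.
    apply: le_lt_trans wR _; rewrite -(ltr_pM2r s0).
    have : r1 * sm <= r1 * s by rewrite ler_wpM2l // ltW.
    by clear -rs4 smr; lra.
  have := stepP a e (h k) (gate_kappa R n)%:C (c k) (eta k) (f (w k)) (rho k).
  rewrite /= -wk gate_cot_step_cast; [|nlia|nlia|nlia].
  move=> /(_ (lexx _) r0 eR hR erho kap ckth etak (fE _ wr1)) [].
  rewrite -(wS _ mk) => wE cE; split=> //.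
  have mk1 : (m <= k)%N by nlia.
  rewrite !big_nat_recr //= mulrDr.
  have -> : c k.+1 - c m - (\sum_(m <= j < k) (q j + y j) + (q k + y k)) =
     (c k - c m - \sum_(m <= j < k) (q j + y j)) + (c k.+1 - c k - (q k + y k)).
    by ring.
  apply: le_cmodD => //.
  have -> : q k + y k = gate_drift a e (h k) (eta k) (rho k).
    by rewrite /gate_drift /q /y; ring.
  apply: le_trans cE _.
  (* The weight at the minimum is one of the two on the right; adding both avoids splitting the sum
     at the middle. *)
  have pmu : p (mu k) <= p k + p (n - k)%N.
    have := root_weight_ge0 R k; have := root_weight_ge0 R (n - k).
    by rewrite /p /mu; case: leqP => _; [rewrite lerDl | rewrite lerDr].
  apply: (@le_trans _ _ (D * p (mu k))); last by rewrite ler_wpM2l.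
  have rr : rho k ^+ 2 <= (4 / s ^+ 2) ^+ 2.
    by rewrite muE lerXn2r ?nnegrE ?(ltW r0) // divr_ge0.
  rewrite /p /root_weight -/s -muE.
  apply: (@le_trans _ _ (C1 * ((1 + B) * s) * (4 / s ^+ 2) ^+ 2)).
    apply: ler_pM => //; last by rewrite ler_wpM2l.
      by rewrite mulr_ge0 // addr_ge0 // cmod_ge0.
    by rewrite sqr_ge0.
  rewrite le_eqVlt; apply/orP; left; apply/eqP.
  by rewrite /D; field; rewrite gt_eqF.
have PmI i : (m + i <= n - m)%N -> P (m + i)%N.
  elim: i => [_|i IH mi]; last first.
    by rewrite addnS; apply: step; [nlia | apply: IH; nlia].
  rewrite addn0; split; last by rewrite !big_geq // !subrr cmod0 mulr0.
  have mm : (m <= m <= n - m)%N by nlia.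
  apply: frame_ptK => //; have [_ _ ->] := castP _ mm.
  by rewrite -cmod_eq0 cmod_real normr_eq0 expf_neq0 // gt_eqF // rho0.
have nmm : (m <= n - m <= n - m)%N by nlia.
have Pn : P (n - m)%N.
  by have := PmI (n - m - m)%N; rewrite subnKC; [apply; nlia | nlia].
have mun : mu (n - m)%N = m by rewrite /mu; nlia.
have cn := bound _ nmm Pn; rewrite mun -/sm in cn.
case: Pn => wn cn'; split=> //.
  by apply: le_trans cn _; rewrite ler_wpM2r ?sqrtr_ge0 //; clear -D0 Y0; lra.
have hy := odd_sum_total y_odd y_le m0 Y0 (ltnW mn).
have -> : c (n - m)%N - c m - \sum_(m <= j < n - m) q j =
   (c (n - m)%N - c m - \sum_(m <= j < n - m) (q j + y j)) + \sum_(m <= j < n - m) y j.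
  by rewrite big_split /=; ring.
have sm0 : 0 < sm by clear -sm2; lra.
apply: (@le_trans _ _ (D * (8 / sm) + Y / m%:R)).
  apply: le_cmodD => //; apply: le_trans cn' _.
  by rewrite ler_wpM2l // sump.
apply: (@le_trans _ _ (8 * D / sm + Y / sm)).
  rewrite mulrCA lerD // ?mulrA // ler_wpM2l // lef_pV2 ?posrE ?ltr0n //.
  by rewrite -smm; clear -sm2; nra.
rewrite -mulrDl ler_wpM2r ?invr_ge0 ?(ltW sm0) //.
by clear -B1; lra.
Qed.
End gate_passage.

(** * Limits in the complex plane *)

Section complex_limits.
Variable R : realType.
Local Notation N := (@Normc.normc R).

(** Convergence with a real radius. The norm of [R[i]] is complex valued, and its order would bring
    a condition on imaginary parts into each estimate; [climP] returns to the topological notion. *)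
Definition clim {T : Type} (F : set_system T) (g : T -> R[i]) (l : R[i]) :=
  forall e : R, 0 < e -> \forall t \near F, N (g t - l) < e.

Lemma climP {T : Type} (F : set_system T) {FF : Filter F} (g : T -> R[i]^o) (l : R[i]^o) :
  g @ F --> l <-> clim F g l.
Proof.
have H := @cvgrPdist_lt _ R[i]^o _ F FF g l; split.
  move/H => {}H e e0; have e0' : 0 < e%:C :> R[i] by rewrite ltcR.
  by apply: filterS (H _ e0') => t; rewrite cmodE ltcR cmod_distC.
move=> gl; apply/H => e; rewrite ltcE /= => /andP[/eqP e1 e2].
apply: filterS (gl _ e2) => t; rewrite cmod_distC => h.
by rewrite cmodE ltcE /= h andbT; apply/eqP; rewrite e1.
Qed.

Section filter.
Context {T : Type} {F : set_system T} {FF : Filter F}.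
Implicit Types (g : T -> R[i]) (l : R[i]).

Lemma clim_cst l : clim F (fun=> l) l.
Proof. by move=> e e0; apply: nearW => t; rewrite subrr cmod0. Qed.

Lemma clim_near g g' l : (\forall t \near F, g t = g' t) -> clim F g l -> clim F g' l.
Proof. by move=> gg' gl e e0; apply: filterS2 gg' (gl _ e0) => t <-. Qed.

Lemma clim_ext g g' l : g =1 g' -> clim F g l -> clim F g' l.
Proof. by move=> gg'; apply: clim_near; apply: nearW. Qed.

Lemma climD g1 g2 l1 l2 : clim F g1 l1 -> clim F g2 l2 ->
  clim F (fun t => g1 t + g2 t) (l1 + l2).
Proof.
move=> h1 h2 e e0; have e2 : 0 < e / 2 by rewrite divr_gt0.
apply: filterS2 (h1 _ e2) (h2 _ e2) => t {}h1 {}h2.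
rewrite (_ : _ - _ = (g1 t - l1) + (g2 t - l2)); last by ring.
by apply: le_lt_trans (cmod_triangle _ _) _; lra.
Qed.

Lemma clim_sub g l : clim F g l <-> clim F (fun t => g t - l) 0.
Proof. by split=> h e e0; apply: filterS (h _ e0) => t; rewrite subr0. Qed.

Lemma clim_le g l (b : T -> R) : clim F (fun t => (b t)%:C) 0 ->
  (\forall t \near F, N (g t - l) <= b t) -> clim F g l.
Proof.
move=> b0 gb e e0; apply: filterS2 gb (b0 _ e0) => t h.
by rewrite subr0 cmod_real => h'; apply: le_lt_trans h (le_lt_trans (ler_norm _) h').
Qed.

Lemma clim_bounded g l : clim F g l -> \forall t \near F, N (g t) <= N l + 1.
Proof.
move=> h; apply: filterS (h _ ltr01) => t ht.
by have := cmodB_ge (g t) l; lra.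
Qed.

Lemma climM g1 g2 l1 l2 : clim F g1 l1 -> clim F g2 l2 ->
  clim F (fun t => g1 t * g2 t) (l1 * l2).
Proof.
move=> h1 h2 e e0; have Nl1 := cmod_ge0 l1; have Nl2 := cmod_ge0 l2.
pose d := e / (N l1 + N l2 + 2).
have d0 : 0 < d by rewrite divr_gt0 //; lra.
have dE : d * (N l1 + N l2 + 2) = e by rewrite divfK // gt_eqF //; lra.
apply: filterS3 (clim_bounded h1) (h1 _ d0) (h2 _ d0) => t b1 {}h1 {}h2.
rewrite (_ : _ - _ = g1 t * (g2 t - l2) + (g1 t - l1) * l2); last by ring.
apply: (@le_lt_trans _ _ ((N l1 + 1) * d + d * N l2)).
  by apply: le_cmodD; apply: le_cmodM => //; apply: ltW.
by rewrite -dE; lra.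
Qed.

Lemma climN g l : clim F g l -> clim F (fun t => - g t) (- l).
Proof. by move=> h e e0; apply: filterS (h _ e0) => t; rewrite -cmodN !opprB opprK addrC. Qed.

Lemma climB g1 g2 l1 l2 : clim F g1 l1 -> clim F g2 l2 ->
  clim F (fun t => g1 t - g2 t) (l1 - l2).
Proof. by move=> h1 h2; apply: climD h1 (climN h2). Qed.

Lemma climV g l : l != 0 -> clim F g l -> clim F (fun t => (g t)^-1) l^-1.
Proof.
rewrite -cmod_gt0 => l0 h e e0.
have l20 : 0 < N l / 2 by rewrite divr_gt0.
have d0 : 0 < e * (N l ^+ 2 / 2) by rewrite mulr_gt0 // divr_gt0 // exprn_gt0.
apply: filterS2 (h _ l20) (h _ d0) => t h1 h2.
have gt2 : N l / 2 <= N (g t) by have := cmodB_ge l (l - g t); rewrite subKr cmod_distC; lra.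
have g0 : g t != 0 by rewrite -cmod_gt0; lra.
have ln0 : l != 0 by rewrite -cmod_gt0.
rewrite (_ : _ - _ = (l - g t) / (g t * l)); last by field; rewrite g0 ln0.
rewrite cmodM cmodV cmodM cmod_distC ltr_pdivrMr; last by rewrite mulr_gt0 // cmod_gt0.
apply: lt_le_trans h2 _; rewrite ler_wpM2l //; first exact: ltW.
by rewrite expr2 mulrAC ler_wpM2r // ltW.
Qed.

Lemma climX g l n : clim F g l -> clim F (fun t => g t ^+ n) (l ^+ n).
Proof.
move=> h; elim: n => [|n IH]; first by apply: clim_ext (clim_cst 1).
by rewrite exprS; apply: clim_ext (climM h IH) => t; rewrite exprS.
Qed.
End filter.

Section proper.
Context {T : Type} {F : set_system T} {FF : ProperFilter F}.

Lemma clim_N_le (g : T -> R[i]) l (B : R) : clim F g l ->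
  (\forall t \near F, N (g t) <= B) -> N l <= B.
Proof.
move=> h gB; apply/ler_addgt0Pr => e e0.
have [t [h1 h2]] := filter_ex (filterI (h _ e0) gB).
by have := cmodB_ge l (l - g t); rewrite subKr cmod_distC; lra.
Qed.

Lemma clim_unique (g : T -> R[i]) l l' : clim F g l -> clim F g l' -> l = l'.
Proof.
move=> h h'; apply/eqP; rewrite -subr_eq0 -cmod_eq0 eq_le cmod_ge0 andbT.
apply: (@clim_N_le (fun t => g t - g t)); first exact: climB.
by apply: nearW => t; rewrite subrr cmod0.
Qed.
End proper.

Definition ccont (f : R[i] -> R[i]) (l : R[i]) :=
  forall e : R, 0 < e -> exists2 d : R, 0 < d & forall x, N (x - l) < d -> N (f x - f l) < e.

Lemma derivable_ccont (f : R[i]^o -> R[i]^o) (l : R[i]^o) : derivable f l 1 -> ccont f l.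
Proof.
move=> /(@derivable1_diffP _ R[i]^o f l) /(@differentiable_continuous _ _ _ l f) fl e e0.
have /climP /(_ _ e0) : f @ l --> f l by exact: fl.
have nbP := @nbhs_normP _ R[i]^o l.
move=> /nbP [d /=]; rewrite ltcE /= => /andP[/eqP d1 d2] H.
exists (complex.Re d) => // x xl; apply: H => /=.
by rewrite cmodE cmod_distC ltcE /= xl andbT; apply/eqP; rewrite d1.
Qed.

Lemma clim_comp {T : Type} (F : set_system T) {FF : Filter F} (g : T -> R[i]) f l :
  ccont f l -> clim F g l -> clim F (fun t => f (g t)) (f l).
Proof.
move=> fl gl e e0; have [d d0 fd] := fl _ e0.
by apply: filterS (gl _ d0) => t; apply: fd.
Qed.

(** A filter is the intersection of the ultrafilters that contain it: if the required set were not
    in [F], the traces of [F] on its complement would generate a proper filter, and an ultrafilter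
    above it would contradict the hypothesis. *)
Lemma clim_ultra (T : Type) (F : set_system T) {FF : Filter F} (g : T -> R[i]) l :
  (forall G : set_system T, UltraFilter G -> F `<=` G -> clim G g l) -> clim F g l.
Proof.
move=> H e e0; apply: contrapT => nF.
pose A := [set t | N (g t - l) < e].
pose G := filter_from F (fun B => B `\` A).
have GF : ProperFilter G.
  apply: filter_from_proper; first apply: filter_from_filter.
  - by exists setT; apply: filterT.
  - move=> B1 B2 FB1 FB2; exists (B1 `&` B2); first exact: filterI.
    by move=> t [[? ?] ?].
  - move=> B FB; apply: contrapT => nB; apply: nF.
    apply: filterS FB => t Bt; apply: contrapT => nA.
    by apply: nB; exists t.
have [G' [UG' GG']] := ultraFilterLemma GF.
have FG' : F `<=` G' by move=> B FB; apply: GG'; exists B => // t [].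
have A1 := H _ UG' FG' _ e0.
have A2 : G' (~` A) by apply: GG'; exists setT; [apply: filterT | move=> t []].
by have [t []] := filter_ex (filterI A1 A2).
Qed.

Lemma ultra_fmap (T U : Type) (h : T -> U) (G : set_system T) :
  UltraFilter G -> UltraFilter (h @ G).
Proof.
move=> GU; split; first exact: fmap_proper_filter.
move=> H HF GH; rewrite predeqE => A; split; last exact: GH.
move=> HA; have [//|GnA] := in_ultra_setVsetC (h @^-1` A) GU.
have HnA : H (~` A) by apply: GH.
by have [x []] := filter_ex (filterI HA HnA).
Qed.

(** Compactness of a segment, applied separately to real and imaginary parts. *)
Lemma clim_bounded_ultra (T : Type) (G : set_system T) {GU : UltraFilter G}
    (g : T -> R[i]) (B : R) :
  (\forall t \near G, N (g t) <= B) -> exists l, clim G g l.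
Proof.
move=> gB.
have real_lim (h : T -> R) : (\forall t \near G, `|h t| <= B) ->
    exists l : R, h @ G --> l.
  move=> hB.
  have cB : compact `[- B, B]%classic by apply: segment_compact.
  have hG : (h @ G) `[- B, B]%classic.
    by apply: filterS hB => t; rewrite /= in_itv /= ler_norml.
  have [l [_ hl]] : `[- B, B]%classic `&` [set p | h @ G --> p] !=set0.
    by move: cB; rewrite compact_ultra; apply => //; apply: ultra_fmap.
  by exists l.
have le_Im z : `|complex.Im z| <= N z.
  case: z => x y; rewrite /= -sqrtr_sqr ler_wsqrtr //.
  by rewrite lerDr sqr_ge0.
have [x xl] : exists l : R, (fun t => complex.Re (g t)) @ G --> l.
  by apply: real_lim; apply: filterS gB => t; apply: le_trans (cmod_ge_Re _).
have [y yl] : exists l : R, (fun t => complex.Im (g t)) @ G --> l.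
  by apply: real_lim; apply: filterS gB => t; apply: le_trans (le_Im _).
exists (Complex x y) => e e0; have e2 : 0 < e / 2 by rewrite divr_gt0.
move/cvgrPdist_lt : xl => /(_ _ e2) xl; move/cvgrPdist_lt : yl => /(_ _ e2) yl.
apply: filterS2 xl yl => t.
case: (g t) => u v xu yv; rewrite /= in xu yv.
have -> : Complex u v - Complex x y = (u - x)%:C + 'i%C * (v - y)%:C.
  by rewrite [LHS]complexE /=.
apply: le_lt_trans (cmod_triangle _ _) _; rewrite cmodM !cmod_real.
have -> : N 'i%C = 1 by rewrite /= expr0n expr1n /= add0r sqrtr1.
by rewrite mul1r distrC (distrC v); lra.
Qed.

Lemma clim_invn : clim \oo (fun n : nat => (n%:R^-1 : R)%:C) 0.
Proof.
move=> e e0; suff H n : (Num.truncn (e^-1) < n)%N -> N ((n%:R^-1 : R)%:C - 0) < e.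
  by exists (Num.truncn (e^-1)).+1 => // n; apply: H.
move=> nN; rewrite subr0 cmod_real ger0_norm ?invr_ge0 //.
have n0 : 0 < n%:R :> R by rewrite ltr0n; apply: leq_trans nN.
rewrite -[ltRHS]invrK ltf_pV2 ?posrE ?invr_gt0 //.
by apply: lt_le_trans (truncnS_gt _) _; rewrite ler_nat.
Qed.

End complex_limits.

(** * Averaging the perturbation *)

Section averaging.
Variable R : realType.
Local Notation N := (@Normc.normc R).

Lemma abel_sum (tau g : nat -> R[i]) n (T := fun n => \sum_(0 <= k < n) tau k) :
  \sum_(0 <= k < n) tau k * g k =
  T n * g n - \sum_(0 <= k < n) T k.+1 * (g k.+1 - g k).
Proof.
elim: n => [|n IH]; first by rewrite /T !big_geq // mul0r subr0.
rewrite !(@big_nat_recr _ _ _ n) //= IH /T !(@big_nat_recr _ _ _ n) //=; ring.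
Qed.

Lemma clim_cinvn (c : R[i]) : clim \oo (fun n : nat => c * n%:R^-1) 0.
Proof.
rewrite -(mulr0 c); apply: climM; first exact: clim_cst.
by apply: clim_ext (@clim_invn R) => n; rewrite fmorphV rmorph_nat.
Qed.

(** In the summation by parts the boundary term vanishes since [g n n = 0]. What remains is at most
    [L / n] times a sum of [n] partial sums of [tau], each of them [o(n)], so that dividing by [n]
    leaves [o(1)]. *)
Lemma cesaro_weights (tau : nat -> R[i]) (g : nat -> nat -> R) (L : R) : 0 <= L ->
  clim \oo (fun n : nat => n%:R^-1 * \sum_(0 <= k < n) tau k) 0 ->
  (forall n k, (k < n)%N -> `|g n k.+1 - g n k| <= L / n%:R) ->
  (forall n, g n n = 0) ->
  clim \oo (fun n : nat => n%:R^-1 * \sum_(0 <= k < n) tau k * (g n k)%:C) 0.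
Proof.
move=> L0 tau0 gL gn e e0.
pose d := e / (2 * (L + 1)).
have L1 : 0 < 2 * (L + 1) by lra.
have d0 : 0 < d by rewrite divr_gt0.
have dE : d * (2 * (L + 1)) = e by rewrite divfK // gt_eqF.
have [k0 _ k0P] := tau0 _ d0.
pose T n := \sum_(0 <= k < n) tau k.
(* Absorbs the partial sums before [k0], so that [|T k| <= d k + A] holds for every [k]. *)
pose A := \sum_(0 <= k < k0) N (tau k).
have A0 : 0 <= A by apply: sumr_ge0 => j _; apply: cmod_ge0.
have Td k : N (T k) <= d * k%:R + A.
  have [kk|kk] := leqP k0 k.
    have := k0P _ kk; rewrite subr0 cmodM cmodV cmod_nat => h.
    have [k00|k1] := posnP k.
      by rewrite k00 /T big_geq // cmod0 mulr0 add0r.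
    have kR : 0 < k%:R :> R by rewrite ltr0n.
    rewrite mulrC ltr_pdivrMr // in h.
    by rewrite /T; lra.
  apply: (@le_trans _ _ A); last by rewrite lerDr mulr_ge0 // ltW.
  apply: (@le_trans _ _ (\sum_(0 <= j < k) N (tau j))); first exact: le_cmod_sum.
  rewrite /A (@big_cat_nat _ _ _ k 0 k0) //=; last exact: ltnW.
  by rewrite lerDl; apply: sumr_ge0 => j _; apply: cmod_ge0.
have e2 : 0 < e / 2 by rewrite divr_gt0.
have [n1 _ n1P] := @clim_cinvn (A * L)%:C _ e2.
suff H n : (n1 < n)%N -> N (n%:R^-1 * (\sum_(0 <= k < n) tau k * (g n k)%:C) - 0) < e.
  by exists n1.+1 => // n; apply: H.
move=> nn1; have := n1P _ (ltnW nn1).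
rewrite !subr0 !cmodM !cmodV !cmod_nat cmod_real ger0_norm ?mulr_ge0 // => h.
have n0 : 0 < n%:R :> R by rewrite ltr0n; apply: leq_trans nn1.
rewrite (abel_sum tau (fun k => (g n k)%:C)) gn rmorph0 mulr0 sub0r cmodN.
apply: (@le_lt_trans _ _ (n%:R^-1 * \sum_(0 <= k < n) ((d * n%:R + A) * (L / n%:R)))).
  rewrite ler_wpM2l ?invr_ge0 ?(ltW n0) //; apply: le_cmod_sum => k kn.
  apply: le_cmodM; last by rewrite -rmorphB cmod_real gL.
  apply: le_trans (Td _) _; rewrite lerD2r ler_wpM2l ?(ltW d0) // ler_nat.
  by case/andP: kn.
rewrite sumr_const_nat subn0 -(mulr_natr (_ * (L / _)) n).
have -> : n%:R^-1 * ((d * n%:R + A) * (L / n%:R) * n%:R) = d * L + A * L * n%:R^-1.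
  by field; rewrite gt_eqF.
by apply: (@lt_le_trans _ _ (d * L + e / 2)); [rewrite ltrD2l | rewrite -dE; nra].
Qed.

(** Because [1 / rho^2 = sin(e j)^2 / e^2], the sum is close to the mean of [sigma] against the
    weights [(2/n) sin(e j)^2]. These vanish at [j = n] and have increments [O(1/n)] before the
    factor [2/n], as [cesaro_weights] asks. *)
Lemma gate_average (sigma : nat -> R[i]) (u : R[i]) (M : R)
    (eta : nat -> nat -> R[i]) (b : nat -> R) (m : nat) :
  (forall k, N (sigma k) <= M) ->
  clim \oo (fun n : nat => n%:R^-1 * \sum_(0 <= k < n) sigma k) u ->
  clim \oo (fun n : nat => (b n)%:C) 0 ->
  (forall n k, (k < n)%N -> N (eta n k - 2 * (gate_eps R n)%:C ^+ 2 * sigma k / n%:R)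
      <= gate_eps R n ^+ 2 * (b n / n%:R)) ->
  clim \oo (fun n => \sum_(m <= j < n - m) eta n j / (gate_rho R n j ^+ 2)%:C) u.
Proof.
move=> sM su b0 etaP.
have M0 : 0 <= M := le_trans (cmod_ge0 _) (sM 0).
pose s n k : R := sin (gate_eps R n * k%:R) ^+ 2.
have s1 n k : 0 <= s n k <= 1.
  by rewrite /s sqr_ge0 /= sin2cos2 gerBl sqr_ge0.
(* Centring [sigma] at [u] gives means tending to 0; the subtracted constant is restored by
   [sum_sin2]. *)
have lim1 : clim \oo (fun n =>
    2 * (n%:R^-1 * \sum_(0 <= k < n) (sigma k - u) * (s n k)%:C) + u) u.
  have h : clim \oo (fun n => n%:R^-1 * \sum_(0 <= k < n) (sigma k - u) * (s n k)%:C) 0.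
    apply: (@cesaro_weights _ _ (2 * pi)); first by rewrite mulr_ge0 // pi_ge0.
    - apply: clim_near (iffLR (clim_sub _ _) su); exists 1%N => // n n0.
      rewrite sumrB sumr_const_nat subn0 mulrBr -[u *+ n]mulr_natl mulKf //.
      by rewrite pnatr_eq0 -lt0n.
    - move=> n k kn; have n0 : (0 < n)%N by lia.
      rewrite /s; set x := sin _; set y := sin _.
      rewrite subr_sqr normrM (_ : 2 * pi / n%:R = gate_eps R n * 2); last first.
        by rewrite /gate_eps; ring.
      apply: ler_pM => //.
        apply: le_trans (sin_lipschitz _ _) _.
        rewrite -mulrBr -natrB // subSnn mulr1 ger0_norm //.
        by apply/ltW/gate_eps_gt0.
      by apply: le_trans (ler_normD _ _) _; have := sin_max (gate_eps R n * k%:R);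
         have := sin_max (gate_eps R n * k.+1%:R); rewrite -/x -/y; lra.
    - move=> n; have [->|n0] := posnP n; first by rewrite /s mulr0 sin0 expr0n.
      by rewrite /s gate_epsn // sinpi expr0n.
  by rewrite -[X in clim _ _ X](add0r u) -[X in X + u](mulr0 2);
     apply: climD; [apply: climM => //|]; apply: clim_cst.
(* The second term pays for the [2 m] indices left out at the two ends, each of weight at most
   [2 M / n]. *)
have lim2 : clim \oo (fun n => ((b n + (4 * m%:R * M) * n%:R^-1)%R)%:C) 0.
  rewrite -[X in clim _ _ X](addr0 0).
  apply: clim_ext (climD b0 (clim_cinvn (4 * m%:R * M)%:C)) => n.
  by rewrite [RHS]rmorphD [X in _ = _ + X]rmorphM fmorphV rmorph_nat.
rewrite -[u]add0r.
apply: clim_ext (climD (_ : clim \oo (fun n =>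
   \sum_(m <= j < n - m) eta n j / (gate_rho R n j ^+ 2)%:C
   - (2 * (n%:R^-1 * \sum_(0 <= k < n) (sigma k - u) * (s n k)%:C) + u)) 0) lim1) => [n|].
  by rewrite subrK.
apply: clim_le lim2 _; exists (m.*2).+2 => // n mn.
have {}mn : (m.*2.+2 <= n)%N := mn.
have n0 : (0 < n)%N by lia.
have nR : 0 < n%:R :> R by rewrite ltr0n.
have nC : n%:R != 0 :> R[i] by rewrite pnatr_eq0 -lt0n.
have e0 := @gate_eps_gt0 R n n0.
rewrite subr0.
have -> : 2 * (n%:R^-1 * \sum_(0 <= k < n) (sigma k - u) * (s n k)%:C) + u
   = \sum_(0 <= k < n) (2 / n%:R) * (sigma k * (s n k)%:C).
  have -> : \sum_(0 <= k < n) (sigma k - u) * (s n k)%:C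
     = \sum_(0 <= k < n) sigma k * (s n k)%:C - u * (n%:R / 2)%:C.
    rewrite -(sum_sin2 R (n := n)); last by lia.
    rewrite rmorph_sum big_distrr /= -sumrB; apply: eq_bigr => k _.
    by rewrite mulrBl.
  rewrite -big_distrr /= rmorphM fmorphV !rmorph_nat; field.
  by rewrite nC.
rewrite (@big_cat_nat _ _ _ m 0 n) /=; [|lia|lia].
rewrite (@big_cat_nat _ _ _ (n - m)%N m n) /=; [|lia|lia].
have small k : N ((2 / n%:R) * (sigma k * (s n k)%:C)) <= 2 / n%:R * M.
  have /andP[s0 s1'] := s1 n k.
  rewrite -[M]mulr1; apply: le_cmodM; first by rewrite cmodM cmodV !cmod_nat.
  by apply: le_cmodM => //; rewrite cmod_real ger0_norm.
rewrite (_ : _ - _ = (\sum_(m <= j < n - m) eta n j / (gate_rho R n j ^+ 2)%:C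
   - \sum_(m <= j < n - m) (2 / n%:R) * (sigma j * (s n j)%:C))
   - (\sum_(0 <= j < m) (2 / n%:R) * (sigma j * (s n j)%:C)
     + \sum_(n - m <= j < n) (2 / n%:R) * (sigma j * (s n j)%:C))); last by ring.
apply: le_cmodB; last first.
  rewrite (_ : 4 * m%:R * M * n%:R^-1 = \sum_(0 <= j < m) (2 / n%:R * M)
     + \sum_(n - m <= j < n) (2 / n%:R * M)).
    by apply: le_cmodD; apply: le_cmod_sum => j _; apply: small.
  rewrite !sumr_const_nat subn0 subKn; last by lia.
  by rewrite -(mulr_natr (2 / _ * M) m); ring.
rewrite -sumrB; apply: (@le_trans _ _ (\sum_(m <= j < n - m) (b n / n%:R))).
  apply: le_cmod_sum => j jm; have jn : (0 < j < n)%N || (j == 0%N) by lia.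
  have rE : ((gate_rho R n j ^+ 2)%:C)^-1 = (s n j)%:C / (gate_eps R n)%:C ^+ 2.
    rewrite -fmorphV -rmorphXn -fmorphV -rmorphM; congr (_%:C).
    by rewrite /gate_rho /s exprMn invfM mulrC exprVn invrK.
  rewrite rE (_ : _ - _ = (eta n j - 2 * (gate_eps R n)%:C ^+ 2 * sigma j / n%:R)
     * ((s n j)%:C / (gate_eps R n)%:C ^+ 2)); last first.
    field; rewrite nC -cmod_eq0 cmod_real normr_eq0 gt_eqF //.
  apply: (@le_trans _ _ (gate_eps R n ^+ 2 * (b n / n%:R) * (1 * (gate_eps R n ^+ 2)^-1))).
    apply: le_cmodM; first by apply: etaP; lia.
    have /andP[s0 s1'] := s1 n j.
    by apply: le_cmodM; rewrite ?cmodV ?cmodX cmod_real ger0_norm // ltW.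
  by rewrite mul1r mulrAC mulfV ?mul1r // expf_neq0 // gt_eqF.
have b00 : 0 <= b n.
  have := le_trans (cmod_ge0 _) (etaP n 0 n0).
  by rewrite pmulr_rge0 ?exprn_gt0 // pmulr_lge0 // invr_gt0.
rewrite sumr_const_nat -(mulr_natr (b n / _)) mulrAC ler_pdivrMr //.
by rewrite ler_wpM2l // ler_nat; lia.
Qed.

End averaging.

(** * Entrance into the gate *)

Section start.
Variable R : realType.
Local Notation N := (@Normc.normc R).

(** A fixed number of steps with vanishing perturbation follows the orbit of [f]. It serves twice:
    before the gate, and along an ultrafilter for the last steps after it. *)
Lemma clim_orbit {T : Type} {F : set_system T} {FF : Filter F} (f : R[i] -> R[i])
    (w : T -> nat -> R[i]) (x : R[i]) (m : nat) :
  clim F (fun t => w t 0) x ->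
  (forall k, (k < m)%N -> clim F (fun t => w t k.+1 - f (w t k)) 0) ->
  (forall k, (k < m)%N -> ccont f (iter k f x)) ->
  clim F (fun t => w t m) (iter m f x).
Proof.
move=> w0; elim: m => [|m IH] wS fc //.
rewrite /= -[f _]addr0.
apply: (@clim_ext _ _ _ _ (fun t => f (w t m) + (w t m.+1 - f (w t m)))) => [t|];
  first by rewrite addrC subrK.
apply: climD; last exact: wS.
apply: clim_comp; first exact: fc.
by apply: IH => k km; [apply: wS | apply: fc]; apply: ltnW.
Qed.

Lemma clim_gate_eps : clim \oo (fun n => (gate_eps R n)%:C) 0.
Proof.
apply: clim_ext (clim_cinvn pi%:C) => n.
by rewrite rmorphM fmorphV rmorph_nat.
Qed.

Lemma clim_gate_cot k : (0 < k)%N -> clim \oo (fun n => (gate_cot R n k)%:C) k%:R^-1.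
Proof.
move=> k0; have kR : 0 < k%:R :> R by rewrite ltr0n.
have lim : clim \oo (fun n => ((gate_eps R n * k%:R) ^+ 2)%:C) 0.
  rewrite (_ : 0 = (0 * k%:R%:C) ^+ 2 :> R[i]); last by rewrite mul0r expr0n.
  apply: clim_ext (climX 2 (climM clim_gate_eps (clim_cst _))) => n.
  by rewrite [RHS]rmorphXn; congr (_ ^+ 2); rewrite [RHS]rmorphM.
apply: clim_le lim _.
have k1 : 0 < (k%:R)^-1 :> R by rewrite invr_gt0.
have small := clim_gate_eps k1.
have pos : \forall n \near \oo, (0 < n)%N by exists 1%N.
apply: filterS2 small pos => n; rewrite subr0 cmod_real => small n0.
have {}small : gate_eps R n * k%:R <= 1.
  by apply/ltW; rewrite -ltr_pdivlMr // mul1r; apply: le_lt_trans (ler_norm _) small.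
have -> : (gate_cot R n k)%:C - k%:R^-1 = ((k%:R * gate_cot R n k - 1) / k%:R)%:C.
  move: (gate_cot R n k) => h.
  rewrite [RHS]rmorphM rmorphB rmorphM fmorphV rmorph_nat rmorph1; field.
  by rewrite pnatr_eq0 -lt0n.
rewrite cmod_real normrM normfV normr_nat ler_pdivrMr //.
apply: le_trans (gate_cot_asympt k0 small n0) _.
by rewrite ler_peMr ?sqr_ge0 // ler1n.
Qed.

(** As [e] tends to 0 the frame degenerates to [h = 1 / m], and the coordinate becomes
    [(W + 1/m) / (- W/m)]. *)
Lemma clim_gate_start (w : nat -> nat -> R[i]) (W : R[i]) m : (0 < m)%N -> W != 0 ->
  clim \oo (fun n => w n m) W ->
  clim \oo (fun n => (gate_eps R n)%:C ^+ 2 - w n m * (gate_cot R n m)%:C) (- (W / m%:R)) /\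
  clim \oo (fun n => gate_coord n (w n) m) (- W^-1 - m%:R).
Proof.
move=> m0 W0 wW; have mC : m%:R != 0 :> R[i] by rewrite pnatr_eq0 -lt0n.
have d : clim \oo (fun n =>
    (gate_eps R n)%:C ^+ 2 - w n m * (gate_cot R n m)%:C) (- (W / m%:R)).
  have -> : - (W / m%:R) = 0 ^+ 2 - W * m%:R^-1 by rewrite expr0n sub0r.
  apply: climB; first exact: (climX 2 clim_gate_eps).
  by apply: climM => //; apply: clim_gate_cot.
split=> //.
have -> : - W^-1 - m%:R = (W + m%:R^-1) * (- (W / m%:R))^-1.
  by field; rewrite mC W0.
apply: climM; first by apply: climD => //; apply: clim_gate_cot.
by apply: climV => //; rewrite oppr_eq0 mulf_neq0 // invr_neq0.
Qed.

(** In the coordinate [-1/w] the map is a translation by 1 up to [O(w)]. With [f w = w (1 + v)] and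
    [v = w + p], where [p = O(w^2)], the error is exactly [(p - w v) / (w (1 + v))]. *)
Lemma fatou_step (f : R[i] -> R[i]) (a : R[i]) (r1 K : R) : 0 < r1 -> 0 <= K ->
  (forall w, N w < r1 -> N (f w - (w + w ^+ 2 + a * w ^+ 3)) <= K * N w ^+ 4) ->
  exists C r2 : R, [/\ 0 <= C, 0 < r2, r2 <= r1 &
    forall w, w != 0 -> N w < r2 ->
      f w != 0 /\ N (- (f w)^-1 + w^-1 - 1) <= C * N w].
Proof.
move=> r10 K0 fE; have Na := cmod_ge0 a.
have L0 : 0 < N a + K + 4 by lra.
exists (2 * (N a + K + 2)), (Num.min r1 (N a + K + 4)^-1); split.
- lra.
- by rewrite lt_min r10 invr_gt0.
- by rewrite ge_min lexx.
move=> w w0; rewrite lt_min => /andP[wr1 wL].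
have {}fE := fE _ wr1.
have Nw : 0 < N w by rewrite cmod_gt0.
have wL' : N w * (N a + K + 4) < 1 by rewrite -ltr_pdivlMr // div1r.
set A := N a + K in L0 wL wL' *; have A0 : 0 <= A by rewrite /A; lra.
have w4 : N w < 1 / 4 by nra.
pose p := (f w - (w + w ^+ 2)) / w.
pose v := w + p.
have pA : N p <= A * N w ^+ 2.
  have -> : p = (f w - (w + w ^+ 2 + a * w ^+ 3)) / w + a * w ^+ 2.
    by rewrite /p; field.
  rewrite (_ : A * _ = K * N w ^+ 2 + N a * N w ^+ 2); last by rewrite /A; ring.
  apply: le_cmodD; last by rewrite cmodM cmodX.
  rewrite cmodM cmodV ler_pdivrMr //; apply: le_trans fE _.
  rewrite -mulrA ler_wpM2l // -exprSr [leLHS]exprS ger_pMl ?exprn_gt0 //; lra.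
have AW : A * N w ^+ 2 <= N w.
  by rewrite expr2 mulrA ger_pMl // mulrC; nra.
have v2 : N v <= 2 * N w.
  by apply: le_trans (cmod_triangle _ _) _; lra.
have v1 : 1 / 2 <= N (1 + v).
  by have := cmodD_ge 1 v; rewrite cmod1; lra.
have v10 : 1 + v != 0 by rewrite -cmod_gt0; lra.
have fwE : f w = w * (1 + v) by rewrite /v /p; field.
split; first by rewrite fwE mulf_neq0.
have -> : - (f w)^-1 + w^-1 - 1 = (p - w * v) / (w * (1 + v)).
  by rewrite fwE (_ : p = v - w); [field; rewrite v10 w0 | rewrite /v; ring].
rewrite cmodM cmodV [N (w * _)]cmodM ler_pdivrMr; last by rewrite mulr_gt0 ?cmod_gt0.
apply: (@le_trans _ _ (A * N w ^+ 2 + N w * (2 * N w))).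
  by apply: le_cmodB => //; apply: le_cmodM.
rewrite (_ : _ + _ = 2 * (A + 2) * N w * (N w * (1 / 2))); last by field.
rewrite ler_wpM2l ?mulr_ge0 ?(ltW Nw) //; first lra.
by rewrite ler_wpM2l // ltW.
Qed.

(** The map [-1/w] sends a disc whose boundary passes through 0 onto a half-plane. *)
Lemma attracting_petalP (r : R) (w : R[i]) : 0 < r ->
  attracting_petal r w <-> w != 0 /\ (2 * r)^-1 < complex.Re (- w^-1).
Proof.
move=> r0; rewrite /attracting_petal /mkset cmodE ltcR.
case: w => x y /=; rewrite addr0.
have -> : (Complex x y != 0) = (0 < x ^+ 2 + y ^+ 2).
  rewrite lt0r addr_ge0 ?sqr_ge0 // andbT paddr_eq0 ?sqr_ge0 // !sqrf_eq0.
  by rewrite eq_complex.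
rewrite -[ltRHS](ger0_norm (ltW r0)) -sqrtr_sqr ltr_sqrt ?exprn_gt0 //.
have -> : ((x + r) ^+ 2 + y ^+ 2 < r ^+ 2) = (x ^+ 2 + y ^+ 2 < - x * (2 * r)).
  by rewrite -subr_gt0 -[RHS]subr_gt0; congr (0 < _); ring.
split.
  move=> h; have n0 : 0 < x ^+ 2 + y ^+ 2.
    rewrite lt0r addr_ge0 ?sqr_ge0 // andbT; apply/eqP => s0.
    have x0 : x = 0.
      by move/eqP: s0; rewrite paddr_eq0 ?sqr_ge0 // sqrf_eq0 => /andP[/eqP].
    by move: h; rewrite s0 x0 oppr0 mul0r ltxx.
  split=> //; rewrite -mulNr ltr_pdivlMr // mulrC ltr_pdivrMr //; lra.
move=> [n0]; rewrite -mulNr ltr_pdivlMr // mulrC ltr_pdivrMr //; lra.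
Qed.

Lemma repelling_petalP (r : R) (w : R[i]) : 0 < r ->
  repelling_petal r w <-> w != 0 /\ (2 * r)^-1 < complex.Re (w^-1).
Proof.
move=> r0; have := attracting_petalP (- w) r0.
rewrite invrN opprK oppr_eq0 => <-.
by rewrite /attracting_petal /repelling_petal /mkset (addrC (- w)) distrC.
Qed.

(** Since [|w| < 2 r] in the petal, [4 C r <= 1] makes the error of each translation at most [1/2].
    The petal is therefore invariant and the real part of [-1/w_i] exceeds [i/2]. Then
    [|w_i| <= 2/i], and inserting this into the errors gives a harmonic sum, bounded by a square
    root. *)
Lemma petal_orbit (f : R[i] -> R[i]) (C r2 r : R) :
  0 <= C -> 0 < r -> 2 * r <= r2 -> 4 * C * r <= 1 ->
  (forall w, w != 0 -> N w < r2 -> f w != 0 /\ N (- (f w)^-1 + w^-1 - 1) <= C * N w) ->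
  forall w, attracting_petal r w ->
  (forall i, attracting_petal r (iter i f w)) /\
  exists A : R, 0 <= A /\
   forall i, (0 < i)%N -> N (- (iter i f w)^-1 - i%:R) <= A * Num.sqrt i%:R.
Proof.
move=> C0 r0 rr2 Cr step w wP.
have small z : attracting_petal r z -> N z < 2 * r.
  rewrite /attracting_petal /mkset cmodE ltcR => zr.
  have := cmodB_ge z (- r%:C); rewrite opprK cmodN cmod_real gtr0_norm //; lra.
have inv i : attracting_petal r (iter i f w) /\ i%:R / 2 < complex.Re (- (iter i f w)^-1).
  elim: i => [|i [iP iR]].
    split=> //; rewrite mul0r; case/(attracting_petalP _ r0): wP => _.
    by apply: lt_trans; rewrite invr_gt0; lra.
  have sm := small _ iP.
  case/(attracting_petalP _ r0): iP => z0 zr.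
  have zr2 : N (iter i f w) < r2 by lra.
  have [fz0 st] := step _ z0 zr2; rewrite -/(iter i.+1 f w) in fz0 st *.
  set z := iter i f w in z0 zr sm st iR *; set z' := iter i.+1 f w in fz0 st *.
  have : `|complex.Re (- z'^-1 + z^-1 - 1)| <= 1 / 2.
    apply: le_trans (cmod_ge_Re _) _; apply: le_trans st _.
    have : C * N z <= C * (2 * r) by rewrite ler_wpM2l // ltW.
    lra.
  have -> : complex.Re (- z'^-1 + z^-1 - 1) = complex.Re (- z'^-1) - complex.Re (- z^-1) - 1.
    by case: (z'^-1) (z^-1) => [? ?] [? ?] /=; rewrite opprK.
  rewrite ler_norml => /andP[hz _].
  split; first by apply/(attracting_petalP _ r0); split=> //; lra.
  by rewrite -natr1; lra.
split=> [i|]; first by have [] := inv i.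
have Nle i : (0 < i)%N -> N (iter i f w) <= 2 * i%:R^-1.
  move=> i0; have [/(attracting_petalP _ r0)[z0 _] iR] := inv i.
  have iR0 : 0 < i%:R :> R by rewrite ltr0n.
  have : i%:R / 2 <= N (- (iter i f w)^-1).
    apply/ltW/(lt_le_trans iR); apply: le_trans (ler_norm _) (cmod_ge_Re _).
  rewrite cmodN cmodV => h.
  rewrite -[leLHS]invrK (_ : 2 * i%:R^-1 = (i%:R / 2)^-1); last by rewrite invf_div.
  by rewrite lef_pV2 ?posrE ?invr_gt0 ?cmod_gt0 // divr_gt0.
(* The step from [w] itself is estimated by the size of the petal, because [2/i] says nothing at
   [i = 0]. *)
have sumP i : N (- (iter i.+1 f w)^-1 - i.+1%:R) <=
   N (- w^-1) + C * (2 * r) + 2 * C * \sum_(1 <= j < i.+1) j%:R^-1.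
  elim: i => [|i IH].
    rewrite big_geq // mulr0 addr0 /=.
    have [/(attracting_petalP _ r0)[z0 _] _] := inv 0%N.
    have ws := small _ wP.
    have [_ st] := step _ z0 (lt_le_trans ws rr2).
    rewrite (_ : _ - 1 = - w^-1 + (- (f w)^-1 + w^-1 - 1)); last by ring.
    by apply: le_cmodD => //; apply: le_trans st _; rewrite ler_wpM2l // ltW.
  have [iP _] := inv i.+1; have zs := small _ iP.
  case/(attracting_petalP _ r0): iP => z0 _.
  have [_ st] := step _ z0 (lt_le_trans zs rr2).
  rewrite big_nat_recr //= mulrDr addrA.
  rewrite (_ : _ - _ = (- (iter i.+1 f w)^-1 - i.+1%:R)
    + (- (f (iter i.+1 f w))^-1 + (iter i.+1 f w)^-1 - 1)); last first.
    by rewrite -[i.+2%:R]natr1 /=; ring.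
  apply: le_cmodD => //; apply: le_trans st _.
  by rewrite (mulrC 2) -mulrA ler_wpM2l // Nle.
exists (N (- w^-1) + C * (2 * r) + 8 * C); split.
  by rewrite !addr_ge0 ?cmod_ge0 ?mulr_ge0 // ltW.
case=> // i _; apply: le_trans (sumP i) _.
rewrite [leRHS]mulrDl; apply: lerD.
  by rewrite ler_peMr ?sqrt_nat_ge1 // addr_ge0 ?cmod_ge0 // !mulr_ge0 // ltW.
rewrite (_ : 8 * C * _ = 2 * C * (4 * Num.sqrt i.+1%:R)); last by ring.
by rewrite ler_wpM2l ?mulr_ge0 // sum_inv_le.
Qed.

(** The orbit enters the petal at some time [l] and stays in it, hence in [U]; the time shift by [l]
    is absorbed into the constant. *)
Lemma basin_orbit (U : set R[i]) (f : R[i] -> R[i]) (C r2 r : R) :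
  0 <= C -> 0 < r -> 2 * r <= r2 -> 4 * C * r <= 1 ->
  (forall w, w != 0 -> N w < r2 -> f w != 0 /\ N (- (f w)^-1 + w^-1 - 1) <= C * N w) ->
  (forall w, N w < r2 -> U w) ->
  forall w, parabolic_basin U f r w ->
  (forall m, iter_defined U f m w) /\
  exists A m0, [/\ 0 <= A, (0 < m0)%N &
   forall j, (m0 <= j)%N -> attracting_petal r (iter j f w) /\
      N (- (iter j f w)^-1 - j%:R) <= A * Num.sqrt j%:R].
Proof.
move=> C0 r0 rr2 Cr step Ur2 w [l [wdef wP]].
have [inP [A [A0 asy]]] := petal_orbit C0 r0 rr2 Cr step wP.
have iterE j : (l <= j)%N -> iter j f w = iter (j - l) f (iter l f w).
  by move=> lj; rewrite -iterD subnK.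
split.
  move=> m j _; have [jl|lj] := ltnP j l; first exact: wdef.
  rewrite iterE //; apply: Ur2; have := inP (j - l)%N.
  rewrite /attracting_petal /mkset cmodE ltcR => zr.
  have := cmodB_ge (iter (j - l) f (iter l f w)) (- r%:C).
  by rewrite opprK cmodN cmod_real gtr0_norm //; lra.
exists (A + l%:R), l.+1; split=> //; first by rewrite addr_ge0.
move=> j lj; rewrite iterE; last exact: ltnW.
split; first exact: inP.
have jl : (0 < j - l)%N by rewrite subn_gt0.
have := asy _ jl; set z := - _^-1 => h.
have -> : z - j%:R = (z - (j - l)%:R) - l%:R.
  by rewrite natrB 1?ltnW //; ring.
apply: le_trans (cmod_triangleB _ _) _; rewrite mulrDl lerD //.
  by apply: le_trans h _; rewrite ler_wpM2l // ler_wsqrtr // ler_nat leq_subr.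
by rewrite cmod_nat ler_peMr // sqrt_nat_ge1 // (leq_trans _ lj).
Qed.
End start.

(** * Logarithms and the attracting Fatou coordinate *)

Section logarithm.
Variable R : realType.
Local Notation N := (@Normc.normc R).

Lemma cLog_scale (x : R) (z : R[i]) : 0 < x -> z != 0 ->
  cLog (x%:C * z) = cLog z + (ln x)%:C.
Proof.
move=> x0 z0; have Nz : 0 < N z by rewrite cmod_gt0.
rewrite /cLog !cmodE /= cmodM cmod_real gtr0_norm // lnM ?posrE //.
have -> : cArg (x%:C * z) = cArg z.
  rewrite /cArg !cmodE /= cmodM cmod_real gtr0_norm //.
  case: z {z0} Nz => u v Nz /=.
  rewrite !mul0r subr0 addr0 pmulr_rge0 // -mulf_div divff ?gt_eqF // mul1r.
  by [].
by apply/eqP; rewrite eq_complex /= addr0 addrC !eqxx.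
Qed.

Lemma norm_cArg (z : R[i]) : z != 0 -> `|cArg z| = acos (complex.Re z / N z).
Proof.
move=> z0; have Nz : 0 < N z by rewrite cmod_gt0.
have a0 : 0 <= acos (complex.Re z / N z).
  apply: acos_ge0; rewrite -ler_norml normrM normfV (gtr0_norm Nz).
  by rewrite ler_pdivrMr // mul1r cmod_ge_Re.
by rewrite /cArg !cmodE /=; case: ifP => _; rewrite ?normrN ger0_norm.
Qed.

Lemma cLog_near1 (e : R) : 0 < e ->
  exists2 d : R, 0 < d & forall z, N (z - 1) < d -> N (cLog z) < e.
Proof.
move=> e0; have e2 : 0 < e / 2 by rewrite divr_gt0.
have /cvgrPdist_lt /(_ _ e2) : ln x @[x --> (1 : R)] --> ln (1 : R).
  by apply: continuous_ln.
move=> /nbhs_normP [d1 /= d10 lnP].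
pose s := Num.min (e / 2) 1.
have s0 : 0 < s by rewrite lt_min e2 ltr01.
have s1 : s <= 1 by rewrite ge_min lexx orbT.
have pi2 := pi_ge2 R.
have c1 : cos s < 1.
  rewrite -[ltRHS]cos0 ltr_cos ?in_itv /=; lra.
have cN := cos_geN1 s.
exists (Num.min d1 (Num.min (1 / 2) ((1 - cos s) / 4))).
  by rewrite !lt_min d10 /=; lra.
move=> z; rewrite !lt_min => /and3P[z1 z2 z3].
have Nz1 : `|N z - 1| <= N (z - 1).
  have := cmodB_ge z 1; have := cmodB_ge 1 z; rewrite cmod1 (cmod_distC 1).
  by rewrite ler_norml; lra.
have Nz : 1 / 2 < N z by move: Nz1; rewrite ler_norml; lra.
have z0 : z != 0 by rewrite -cmod_gt0; lra.
have lnz : `|ln (N z)| < e / 2.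
  have := lnP (N z); rewrite ln1 /= sub0r normrN; apply.
  by rewrite distrC; apply: le_lt_trans Nz1 z1.
have argz : `|cArg z| < e / 2.
  rewrite norm_cArg //; apply: (@lt_le_trans _ _ s); last by rewrite ge_min lexx.
  have tle : -1 <= complex.Re z / N z <= 1.
    rewrite -ler_norml normrM normfV (@gtr0_norm _ (N z)); last by lra.
    by rewrite ler_pdivrMr; [rewrite mul1r cmod_ge_Re | lra].
  have tcos : cos s < complex.Re z / N z.
    rewrite ltr_pdivlMr; last by lra.
    have : `|complex.Re (z - 1)| <= N (z - 1) by apply: cmod_ge_Re.
    have -> : complex.Re (z - 1) = complex.Re z - 1 by case: (z).
    by move: Nz1; rewrite !ler_norml; nra.
  rewrite ltNge; apply/negP => sle.
  have := acos_ge0 tle; have := acos_lepi tle => h1 h2.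
  move: tcos; rewrite -[X in _ < X]acosK ?in_itv //= ltr_cos ?in_itv //=; lra.
change (N (cLog z) < e).
have -> : cLog z = (ln (N z))%:C + 'i%C * (cArg z)%:C.
  by rewrite [LHS]complexE /cLog !cmodE.
apply: le_lt_trans (cmod_triangle _ _) _; rewrite cmodM !cmod_real.
have -> : N 'i%C = 1 by rewrite /= expr0n expr1n /= add0r sqrtr1.
by lra.
Qed.

(** Scaling by a positive real does not change the argument, so only continuity of [cLog] at 1 is
    involved and the branch cut is never approached. *)
Lemma clim_cLog (T : Type) (F : set_system T) {FF : Filter F} (z : T -> R[i]) (x : T -> R) :
  (\forall t \near F, 0 < x t) -> clim F (fun t => (x t)%:C * z t) 1 ->
  clim F (fun t => cLog (z t) + (ln (x t))%:C) 0.
Proof.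
move=> x0 xz e e0; have [d d0 dP] := cLog_near1 e0.
apply: filterS3 x0 (xz _ d0) (xz _ ltr01) => t xt h h1.
rewrite subr0 -cLog_scale //; first exact: dP.
apply: contraTneq h1 => ->; rewrite mulr0 sub0r cmodN cmod1.
by rewrite ltxx.
Qed.

Lemma clim_sqrtV (A : R) : clim \oo (fun j : nat => (A / Num.sqrt j%:R)%:C) 0.
Proof.
move=> e e0; have [m0 [m00 m0P]] := exists_sqrt_nat_ge (`|A| / e + 1).
suff H j : (m0 <= j)%N -> N ((A / Num.sqrt j%:R)%:C - 0) < e.
  by exists m0 => // j; apply: H.
move=> mj; have := m0P _ mj; have s1 := @sqrt_nat_ge1 R j (leq_trans m00 mj).
move: s1; set s := Num.sqrt _ => s1 h.
have s0 : 0 < s by lra.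
rewrite subr0 cmod_real normrM normfV (gtr0_norm s0) ltr_pdivrMr // mulrC -ltr_pdivrMr //.
by lra.
Qed.

Lemma inv_asympt (z : nat -> R[i]) (A : R) m0 :
  (forall j, (m0 <= j)%N -> N ((z j)^-1 - j%:R) <= A * Num.sqrt j%:R) ->
  clim \oo (fun j : nat => (j%:R : R)%:C * z j) 1 /\ clim \oo z 0.
Proof.
move=> zA.
have h : clim \oo (fun j => (z j)^-1 * j%:R^-1) 1.
  apply: clim_le (clim_sqrtV A) _; exists m0.+1 => // j mj.
  have {}mj : (m0 < j)%N := mj.
  have j0 : (0 < j)%N by apply: leq_trans mj.
  have jR : 0 < j%:R :> R by rewrite ltr0n.
  have s1 := @sqrt_nat_ge1 R j j0; have s0 : 0 < Num.sqrt j%:R :> R by lra.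
  have -> : (z j)^-1 * j%:R^-1 - 1 = ((z j)^-1 - j%:R) * j%:R^-1.
    by rewrite mulrBl mulfV // pnatr_eq0 -lt0n.
  rewrite cmodM cmodV cmod_nat ler_pdivrMr //; apply: le_trans (zA _ (ltnW mj)) _.
  rewrite -{3}(sqr_sqrtr (ltW jR)) (_ : _ / _ * _ = A * Num.sqrt j%:R) //.
  by field; rewrite gt_eqF.
have h1 : clim \oo (fun j : nat => (j%:R : R)%:C * z j) 1.
  have h2 : clim \oo (fun j => ((z j)^-1 * j%:R^-1)^-1) 1.
    by rewrite -[X in clim _ _ X]invr1; apply: climV.
  apply: clim_ext h2 => j.
  by rewrite invfM !invrK mulrC rmorph_nat.
split=> //.
apply: clim_near (_ : clim _ (fun j : nat => (j%:R : R)%:C * z j * j%:R^-1) 0).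
  exists 1%N => // j j0; rewrite rmorph_nat mulrAC mulfV ?mul1r //.
  by rewrite pnatr_eq0 -lt0n.
rewrite -[X in clim _ _ X](mulr0 1); apply: climM h1 _.
by apply: clim_ext (clim_cinvn 1) => j; rewrite mul1r.
Qed.

Lemma within_clim0 (D : set R[i]^o) (g : R[i]^o -> R[i]^o) (T : Type)
    (F : set_system T) {FF : Filter F} (z : T -> R[i]) :
  g @ within D (nbhs (0 : R[i]^o)) --> (0 : R[i]^o) ->
  clim F z 0 -> (\forall t \near F, D (z t)) -> clim F (fun t => g (z t)) 0.
Proof.
move=> /(@climP R _ _ (within_filter _ _)) gD z0 zD e e0.
have := gD _ e0; rewrite near_withinE => /(@nbhs_normP _ R[i]^o (0 : R[i]^o)) [d /=].
rewrite ltcE /= => /andP[/eqP d1 d2] H.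
apply: filterS2 (z0 _ d2) zD => t zt; apply: H => /=.
rewrite subr0 in zt; rewrite cmodE sub0r cmodN ltcE /= zt andbT.
by apply/eqP; rewrite d1.
Qed.

(** From [m0] on, [phi (iter j f w) - j] is constant, and this constant is the value chosen by
    [xget]. The normalization of [phi] at 0, with [cLog (- iter j f w) = - ln j + o(1)], computes it
    as a limit. *)
Lemma attracting_ext_limit (f phi : R[i] -> R[i]) (a : R[i]) (r A : R) (w : R[i]) m0 :
  attracting_Fatou_coordinate f a r phi ->
  (forall j, (m0 <= j)%N -> attracting_petal r (iter j f w) /\
      N (- (iter j f w)^-1 - j%:R) <= A * Num.sqrt j%:R) ->
  clim \oo (fun j : nat => - (iter j f w)^-1 - j%:R - (1 - a) * (ln (j%:R : R))%:C)
    (attracting_Fatou_ext f r phi w).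
Proof.
move=> [_ _ phiS phi0] wP.
have const j : (m0 <= j)%N -> phi (iter j f w) - j%:R = phi (iter m0 f w) - m0%:R.
  elim: j => [|j IH]; first by rewrite leqn0 => /eqP ->.
  rewrite leq_eqVlt => /orP[/eqP <- //|mj].
  rewrite -IH //= phiS; last by have [] := wP j mj.
  by rewrite -[j.+1%:R]natr1; ring.
set xi := attracting_Fatou_ext f r phi w.
have xiE : xi = phi (iter m0 f w) - m0%:R.
  apply: xget_unique.
    by exists m0 => // j mj; split; [have [] := wP j mj | rewrite const].
  move=> y [m1 _ m1P]; have [_ ->] := m1P (maxn m0 m1) (leq_maxr _ _).
  by rewrite const // leq_maxl.
have zA j : (m0 <= j)%N -> N ((- iter j f w)^-1 - j%:R) <= A * Num.sqrt j%:R.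
  by move=> mj; rewrite invrN; have [] := wP j mj.
have [jz z0] := inv_asympt zA.
have w0 : clim \oo (fun j => iter j f w) 0.
  rewrite -[X in clim _ _ X]oppr0.
  by apply: clim_ext (climN z0) => j; rewrite opprK.
have pet : \forall j \near \oo, attracting_petal r (iter j f w).
  by exists m0 => // j mj; have [] := wP j mj.
have h1 : clim \oo (fun j => phi (iter j f w)
    - (- (iter j f w)^-1 + (1 - a) * cLog (- iter j f w))) 0.
  exact: (within_clim0 phi0 w0 pet).
have jpos : \forall j \near \oo, 0 < (j%:R : R) by exists 1%N => // j j0; rewrite ltr0n.
have h2 : clim \oo (fun j => cLog (- iter j f w) + (ln (j%:R : R))%:C) 0.
  exact: clim_cLog.
rewrite (_ : xi = xi - 0 - (1 - a) * 0); last by rewrite mulr0 !subr0.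
apply: clim_near (climB (climB (clim_cst xi) h1) (climM (clim_cst (1 - a)) h2)).
by exists m0 => // j mj; rewrite {1}xiE -(const j mj); ring.
Qed.
End logarithm.

(** * Exit from the gate *)

Section perturbation.
Variable R : realType.
Local Notation N := (@Normc.normc R).

Lemma clim_powRV (alpha : R) : 0 < alpha ->
  clim \oo (fun n : nat => (((n%:R : R) `^ alpha)^-1)%:C) 0.
Proof.
move=> a0 e e0; pose y := e^-1 `^ alpha^-1.
suff H (n : nat) : (Num.truncn y < n)%N -> N (((n%:R : R) `^ alpha)^-1%:C - 0) < e.
  by exists (Num.truncn y).+1 => // n; apply: H.
move=> yn; have yn' : y < n%:R.
  by apply: lt_le_trans (truncnS_gt _) _; rewrite ler_nat.
have n0 : 0 < n%:R :> R by apply: le_lt_trans (powR_ge0 _ _) yn'.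
have := @gt0_ltr_powR _ alpha a0 y n%:R.
rewrite !nnegrE powR_ge0 ltW // => /(_ isT isT yn').
rewrite -powRrM mulVf ?gt_eqF // powRr1 ?invr_ge0 ?(ltW e0) // => h.
rewrite subr0 cmod_real gtr0_norm ?invr_gt0 ?powR_gt0 //.
by rewrite -[ltRHS]invrK ltf_pV2 ?posrE ?powR_gt0 // invr_gt0.
Qed.

(** Writing [eps = e + d] with [d = (pi / n^2) sigma + p], the difference
    [eps^2 - e^2 - 2 e^2 sigma / n] is exactly [2 e p + d^2]. The first estimate feeds
    [gate_average], the second [gate_passage]. *)
Lemma eps_estimates (sigma : nat -> R[i]) (M K alpha : R) (eps : nat -> nat -> R[i]) :
  (forall k, N (sigma k) <= M) -> 0 < alpha ->
  (forall n k, (0 < n)%N -> (k < n)%N ->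
    N (eps n k - ((pi / n%:R)%:C + (pi / n%:R ^+ 2)%:C * sigma k))
    <= K / n%:R `^ (2 + alpha)) ->
  exists (b : nat -> R) (E : R), [/\ 0 <= E, clim \oo (fun n => (b n)%:C) 0,
   forall n k, (k < n)%N ->
     N (eps n k ^+ 2 - (gate_eps R n)%:C ^+ 2
        - 2 * (gate_eps R n)%:C ^+ 2 * sigma k / n%:R)
       <= gate_eps R n ^+ 2 * (b n / n%:R) &
   forall n k, (k < n)%N ->
     N (eps n k ^+ 2 - (gate_eps R n)%:C ^+ 2) <= E * gate_eps R n ^+ 3].
Proof.
move=> sM a0 epsP.
have M0 : 0 <= M := le_trans (cmod_ge0 _) (sM 0).
have K0 : 0 <= K.
  have := le_trans (cmod_ge0 _) (epsP 1 0 isT isT).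
  by rewrite powR1 divr1.
have pi0 := pi_gt0 R; have pige0 := pi_ge0 R; have piN0 : pi != 0 :> R by rewrite gt_eqF.
(* Chosen so that [|d| <= L pi / n^2]; then [d^2] accounts for the term [L ^+ 2 / n] of [b], and
   [2 e p] for the other one. *)
pose L := (pi * M + K) / pi.
have L0 : 0 <= L by apply: divr_ge0 => //; rewrite addr_ge0 // mulr_ge0.
pose b n : R := 2 * K / pi * (n%:R `^ alpha)^-1 + L ^+ 2 * n%:R^-1.
have b0 : clim \oo (fun n => (b n)%:C) 0.
  rewrite (_ : 0 = (2 * K / pi)%:C * 0 + 0); last by rewrite mulr0 addr0.
  apply: clim_ext (climD (climM (clim_cst _) (clim_powRV a0)) (clim_cinvn (L ^+ 2)%:C)) => n.
  by rewrite [RHS]rmorphD [X in _ = X + _]rmorphM [X in _ = _ + X]rmorphM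
     (fmorphV _ n%:R) rmorph_nat.
pose b1 := 2 * K / pi + L ^+ 2.
have b10 : 0 <= b1 by rewrite addr_ge0 ?sqr_ge0 // divr_ge0 ?mulr_ge0 ?pi_ge0 //.
have main n k : (k < n)%N ->
     N (eps n k ^+ 2 - (gate_eps R n)%:C ^+ 2
        - 2 * (gate_eps R n)%:C ^+ 2 * sigma k / n%:R)
       <= gate_eps R n ^+ 2 * (b n / n%:R).
  move=> kn; have n0 : (0 < n)%N by apply: leq_trans kn.
  have nR : 0 < n%:R :> R by rewrite ltr0n.
  have nC : n%:R != 0 :> R[i] by rewrite pnatr_eq0 -lt0n.
  have := epsP n k n0 kn.
  have np : n%:R `^ (2 + alpha) = n%:R ^+ 2 * n%:R `^ alpha.
    rewrite powRD; last by rewrite (gt_eqF nR) implybT.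
    by rewrite -(powR_mulrn 2 (ltW nR)).
  have pa0 : 0 < n%:R `^ alpha :> R by rewrite powR_gt0.
  have pa1 : 1 <= n%:R `^ alpha :> R.
    have n1 : 1 <= n%:R :> R by rewrite ler1n.
    by have := ler_powR n1 (ltW a0); rewrite powRr0.
  rewrite np; set p := eps n k - _ => pK.
  set e := gate_eps R n; set s := sigma k.
  pose d := (pi / n%:R ^+ 2)%:C * s + p.
  have epsE : eps n k = e%:C + d by rewrite /d /p /e /gate_eps -/s; ring.
  have -> : eps n k ^+ 2 - e%:C ^+ 2 - 2 * e%:C ^+ 2 * s / n%:R
     = 2 * e%:C * p + d ^+ 2.
    have -> : p = d - e%:C * s / n%:R.
      have -> : d = e%:C / n%:R * s + p.
        rewrite /d; congr (_ * _ + _).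
        rewrite -(rmorph_nat (real_complex R)) -fmorphV -rmorphM /e /gate_eps.
        by congr (_%:C); field; rewrite gt_eqF.
      by ring.
    by rewrite epsE; field.
  have e0 : 0 < e by apply: gate_eps_gt0.
  have eE : e * n%:R = pi by apply: gate_epsn.
  have dN : N d <= L * pi / n%:R ^+ 2.
    rewrite /L divfK // mulrDl; apply: le_cmodD.
      rewrite mulrAC; apply: le_cmodM; last exact: sM.
      by rewrite cmod_real gtr0_norm // divr_gt0 // exprn_gt0.
    apply: le_trans pK _; rewrite ler_wpM2l // lef_pV2 ?posrE ?mulr_gt0 ?exprn_gt0 //.
    by rewrite ler_peMr // sqr_ge0.
  have -> : e ^+ 2 * (b n / n%:R) = 2 * e * (K / (n%:R ^+ 2 * n%:R `^ alpha))
     + (L * pi / n%:R ^+ 2) ^+ 2.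
    have -> : e = pi / n%:R by [].
    move: pa0 piN0; rewrite /b /L; move: (n%:R `^ alpha) (pi : R) => q P q0 P0.
    by field; rewrite P0 !gt_eqF.
  apply: le_cmodD; last exact: le_cmodX.
  apply: le_cmodM => //; apply: le_cmodM; first by rewrite cmod_nat.
  by rewrite cmod_real gtr0_norm.
exists b, ((2 * M + b1) / pi); split=> //.
  by apply: divr_ge0 => //; rewrite addr_ge0 // mulr_ge0.
move=> n k kn; have n0 : (0 < n)%N by apply: leq_trans kn.
have nR : 0 < n%:R :> R by rewrite ltr0n.
set e := gate_eps R n; set s := sigma k.
have e0 : 0 < e by apply: gate_eps_gt0.
have bb : b n <= b1.
  rewrite /b /b1; apply: lerD; rewrite ler_piMr ?sqr_ge0 ?divr_ge0 ?mulr_ge0 ?pi_ge0 //.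
    rewrite invf_le1 ?powR_gt0 //.
    have n1 : 1 <= n%:R :> R by rewrite ler1n.
    by have := ler_powR n1 (ltW a0); rewrite powRr0.
  by rewrite invf_le1 // ler1n.
have -> : eps n k ^+ 2 - e%:C ^+ 2 =
   (eps n k ^+ 2 - e%:C ^+ 2 - 2 * e%:C ^+ 2 * s / n%:R) + 2 * e%:C ^+ 2 * s / n%:R.
  by rewrite subrK.
rewrite (_ : _ / pi * e ^+ 3 = e ^+ 2 * (b1 / n%:R) + 2 * e ^+ 2 * M / n%:R); last first.
  move: piN0; rewrite /e /gate_eps; move: (pi : R) => P P0.
  by field; rewrite P0 gt_eqF.
apply: le_cmodD.
  apply: le_trans (main n k kn) _.
  by rewrite ler_wpM2l ?sqr_ge0 // ler_wpM2r // invr_ge0 ltW.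
apply: le_cmodM; last by rewrite cmodV cmod_nat.
apply: le_cmodM; last exact: sM.
apply: le_cmodM; first by rewrite cmod_nat.
by rewrite cmodX cmod_real gtr0_norm.
Qed.
End perturbation.

(** * Limits at the exit and identification of the Lavaurs map *)

Section assembly.
Variable R : realType.
Local Notation N := (@Normc.normc R).

Lemma clim_filter_le (T : Type) (F G : set_system T) (g : T -> R[i]) l :
  F `<=` G -> clim F g l -> clim G g l.
Proof. by move=> FG h e e0; apply/FG/h. Qed.

Lemma near_infty_gt (m : nat) : \forall n \near \oo, (m < n)%N.
Proof. by exists m.+1. Qed.

(** At the exit the frame degenerates to [h = -1/m], by the oddness of the cotangent. *)
Lemma clim_frame_exit (G : set_system nat) {FG : Filter G} (c : nat -> R[i]) (l : R[i]) m :
  \oo `<=` G -> (0 < m)%N -> m%:R - l != 0 -> clim G c l ->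
  clim G (fun n => frame_pt (gate_eps R n)%:C (gate_cot R n (n - m))%:C (c n))
    (m%:R - l)^-1.
Proof.
move=> ooG m0 ml0 cl; have mC : m%:R != 0 :> R[i] by rewrite pnatr_eq0 -lt0n.
have hlim : clim G (fun n => (gate_cot R n (n - m))%:C) (- m%:R^-1).
  apply: (clim_filter_le ooG); apply: clim_near (climN (clim_gate_cot m0)).
  apply: filterS (near_infty_gt m) => n mn.
  by rewrite gate_cot_rev ?rmorphN //; lia.
have elim0 := clim_filter_le ooG (@clim_gate_eps R).
have -> : (m%:R - l)^-1 = (0 ^+ 2 * l - - m%:R^-1) * (1 + l * - m%:R^-1)^-1.
  rewrite expr0n mul0r sub0r opprK; field.
  by rewrite mC /= mulrN1.
apply: climM.
  by apply: climB hlim; apply: climM cl; apply: climX.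
apply: climV; last by apply: climD (clim_cst 1) _; apply: climM.
have -> : 1 + l * - m%:R^-1 = (m%:R - l) / m%:R by field.
by rewrite mulf_neq0 // invr_neq0.
Qed.

Lemma mul_sqrt_lt_sub (B t : R) (m : nat) : 0 <= t -> (0 < m)%N ->
  B + t + 1 <= Num.sqrt m%:R -> t < m%:R - B * Num.sqrt m%:R.
Proof.
move=> t0 m0 h; have := @sqrt_nat_ge1 R m m0.
have : (Num.sqrt m%:R) ^+ 2 = m%:R :> R by rewrite sqr_sqrtr.
by move: (Num.sqrt _) h => s h <- s1; nra.
Qed.

Section lavaurs.
Variables (U : set R[i]^o) (f : R[i]^o -> R[i]^o) (a : R[i]^o).
Variables (r1 K C2 r2 r : R).
Hypotheses (r1_gt0 : 0 < r1) (K_ge0 : 0 <= K) (C2_ge0 : 0 <= C2).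
Hypotheses (r2_le : r2 <= r1) (r_gt0 : 0 < r) (rr2 : 2 * r <= r2) (C2r : 4 * C2 * r <= 1).
Hypothesis fE : forall w, N w < r1 ->
  N (f w - (w + w ^+ 2 + a * w ^+ 3)) <= K * N w ^+ 4.
Hypothesis Ur1 : forall w, N w < r1 -> U w.
Hypothesis fU : forall w, U w -> ccont f w.
Hypothesis step : forall w, w != 0 -> N w < r2 ->
  f w != 0 /\ N (- (f w)^-1 + w^-1 - 1) <= C2 * N w.
Variables (phi_i phi_o : R[i]^o -> R[i]^o).
Hypothesis phi_iP : attracting_Fatou_coordinate f a r phi_i.
Hypothesis phi_oP : repelling_Fatou_coordinate f a r phi_o.
Hypothesis phi_o_ext : repelling_inverse_extends U f r phi_o.
Variables (sigma : nat -> R[i]) (u : R[i]) (M : R).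
Hypothesis sigma_le : forall k, N (sigma k) <= M.
Hypothesis sigma_mean : clim \oo (fun n : nat => n%:R^-1 * \sum_(0 <= k < n) sigma k) u.
Variables (eps : nat -> nat -> R[i]^o) (b : nat -> R) (E : R).
Hypothesis E_ge0 : 0 <= E.
Hypothesis b_lim : clim \oo (fun n => (b n)%:C) 0.
Hypothesis eps_mean : forall n k, (k < n)%N ->
     N (eps n k ^+ 2 - (gate_eps R n)%:C ^+ 2
        - 2 * (gate_eps R n)%:C ^+ 2 * sigma k / n%:R)
       <= gate_eps R n ^+ 2 * (b n / n%:R).
Hypothesis eps_le : forall n k, (k < n)%N ->
     N (eps n k ^+ 2 - (gate_eps R n)%:C ^+ 2) <= E * gate_eps R n ^+ 3.
Variable w0 : R[i]^o.
Hypothesis w0_basin : parabolic_basin U f r w0.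

Let w n := perturbed_orbit f (eps n) w0.

Lemma clim_eps2 (k : nat -> nat) : (\forall n \near \oo, (k n < n)%N) ->
  clim \oo (fun n => eps n (k n) ^+ 2) 0.
Proof.
move=> kn; have lim : clim \oo (fun n => (gate_eps R n ^+ 2 + E * gate_eps R n ^+ 3)%:C) 0.
  rewrite (_ : 0 = 0 ^+ 2 + E%:C * 0 ^+ 3); last by rewrite !expr0n mulr0 addr0.
  apply: clim_ext (climD (climX 2 (@clim_gate_eps R))
     (climM (clim_cst E%:C) (climX 3 (@clim_gate_eps R)))) => n.
  move: (gate_eps R n) => e.
  by rewrite [RHS]rmorphD [X in _ = X + _]rmorphXn [X in _ = _ + X]rmorphM
    [X in _ = _ + _ * X]rmorphXn.
apply: clim_le lim _; apply: filterS kn => n kn; rewrite subr0.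
rewrite -[eps n (k n) ^+ 2](subrK ((gate_eps R n)%:C ^+ 2)) addrC.
apply: le_cmodD; last exact: eps_le.
by rewrite cmodX cmod_real real_normK ?num_real.
Qed.

Let w_step n k : w n k.+1 = f (w n k) + eps n k ^+ 2.
Proof. by []. Qed.

Lemma entrance_limit m : clim \oo (fun n => w n m) (iter m f w0).
Proof.
have [w0U _] := basin_orbit C2_ge0 r_gt0 rr2 C2r step
  (fun z h => Ur1 (lt_le_trans h r2_le)) w0_basin.
apply: clim_orbit => [|k km|k km]; first exact: clim_cst.
  apply: clim_ext (clim_eps2 (near_infty_gt k)) => n.
  by rewrite w_step addrC addKr.
by apply: fU; apply: (w0U k.+1).
Qed.

(** Passes [gate_passage] to the limit in [n] for each fixed [m]: the coordinate at [n - m] is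
    bounded, so it has a limit [l] along [G], and [x = 1 / (m - l)]. The error [B / sqrt m] survives
    until [m] grows. *)
Lemma exit_limit (G : set_system nat) {UG : UltraFilter G} : \oo `<=` G ->
  exists (B : R) (m2 : nat), (0 < m2)%N /\ forall m, (m2 <= m)%N ->
   exists x, [/\ clim G (fun n => w n (n - m)%N) x, N (x^-1 - m%:R) <= B * Num.sqrt m%:R &
     N (m%:R - x^-1 - (- (iter m f w0)^-1 - m%:R) - u) <= B / Num.sqrt m%:R].
Proof.
move=> ooG.
have [_ [A [m0 [A0 m00 w0P]]]] := basin_orbit C2_ge0 r_gt0 rr2 C2r step
   (fun z h => Ur1 (lt_le_trans h r2_le)) w0_basin.
(* The entrance coordinate has a limit of modulus at most [A sqrt m]; the added 1 covers its values
   for large finite [n]. *)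
have A1 : 0 <= A + 1 by rewrite addr_ge0.
have [B [m1 [B0 m10 gateP]]] := gate_passage r1_gt0 K_ge0 E_ge0 A1 fE.
have [m3 [m30 m3P]] := exists_sqrt_nat_ge (B + 1).
exists B, (maxn m0 (maxn m1 m3)); split; first by rewrite leq_max m00.
move=> m; rewrite !geq_max => /and3P[mm0 mm1 mm3].
have m_gt0 : (0 < m)%N by apply: leq_trans mm0.
have sm1 := @sqrt_nat_ge1 R m m_gt0.
have smB := m3P m mm3.
have [pet WA] := w0P m mm0.
set W := iter m f w0 in pet WA *.
have [W0 _] := (attracting_petalP W r_gt0).1 pet.
have [dlim clim_m] := clim_gate_start m_gt0 W0 (entrance_limit m).
have mC : m%:R != 0 :> R[i] by rewrite pnatr_eq0 -lt0n.
have d0 : 0 < N (- (W / m%:R)).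
  by rewrite cmod_gt0 oppr_eq0 mulf_neq0 // invr_neq0.
pose c n := gate_coord n (w n) (n - m).
pose q n := \sum_(m <= j < n - m)
   (eps n j ^+ 2 - (gate_eps R n)%:C ^+ 2) / (gate_rho R n j ^+ 2)%:C.
have qlim : clim \oo q u.
  exact: (@gate_average _ _ _ M (fun n j => eps n j ^+ 2 - (gate_eps R n)%:C ^+ 2) b m).
have gate : \forall n \near \oo, [/\ N (c n) <= B * Num.sqrt m%:R,
    w n (n - m)%N = frame_pt (gate_eps R n)%:C (gate_cot R n (n - m))%:C (c n) &
    N (c n - gate_coord n (w n) m - q n) <= B / Num.sqrt m%:R].
  apply: filterS3 (near_infty_gt m.*2) (dlim _ d0) (clim_bounded clim_m) => n mn dn cn.
  apply: (gateP m n (fun j => eps n j ^+ 2 - (gate_eps R n)%:C ^+ 2)) => //.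
  - by move=> k mk; apply: eps_le; nlia.
  - by move=> k mk; rewrite w_step; ring.
  - apply: contraTneq dn => ->; rewrite sub0r cmodN.
    by rewrite ltxx.
  - apply: le_trans cn _; rewrite mulrDl mul1r lerD //.
have gateG := ooG _ gate.
have cB : \forall n \near G, N (c n) <= B * Num.sqrt m%:R.
  by apply: filterS gateG => n [].
have [l cl] := clim_bounded_ultra cB.
have lB : N l <= B * Num.sqrt m%:R by exact: clim_N_le cl cB.
have ml0 : m%:R - l != 0.
  rewrite -cmod_gt0; have := cmodB_ge m%:R l; rewrite cmod_nat.
  move=> h; apply: lt_le_trans h; rewrite subr_gt0; apply: le_lt_trans lB _.
  by rewrite -subr_gt0; apply: mul_sqrt_lt_sub; rewrite ?addr0.
exists (m%:R - l)^-1; split.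
- apply: clim_near (clim_frame_exit ooG m_gt0 ml0 cl).
  by apply: filterS gateG => n [_ ->].
- by rewrite invrK addrC addKr cmodN.
rewrite invrK subKr.
apply: (clim_N_le (climB (climB cl (clim_filter_le ooG clim_m)) (clim_filter_le ooG qlim))).
by apply: filterS gateG => n [].
Qed.

Lemma ultra_Lavaurs (G : set_system nat) {UG : UltraFilter G} : \oo `<=` G ->
  clim G (fun n => w n n) (Lavaurs_map f r phi_i phi_o u w0).
Proof.
move=> ooG.
have [_ [A [m0 [A0 m00 w0P]]]] := basin_orbit C2_ge0 r_gt0 rr2 C2r step
   (fun z h => Ur1 (lt_le_trans h r2_le)) w0_basin.
have xi_lim := attracting_ext_limit phi_iP w0P.
set xi := attracting_Fatou_ext f r phi_i w0 in xi_lim.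
have [B [m2 [m20 exitP]]] := exit_limit ooG.
have /choice[x xP] m : exists x, (m2 <= m)%N ->
   [/\ clim G (fun n => w n (n - m)%N) x, N (x^-1 - m%:R) <= B * Num.sqrt m%:R &
     N (m%:R - x^-1 - (- (iter m f w0)^-1 - m%:R) - u) <= B / Num.sqrt m%:R].
  have [mm|mm] := leqP m2 m; last by exists 0.
  by have [x] := exitP m mm; exists x.
have xinv m : (m2 <= m)%N -> N ((x m)^-1 - m%:R) <= B * Num.sqrt m%:R.
  by move=> /xP[].
have [mx x0] := inv_asympt xinv.
have [m3 [m30 m3P]] := exists_sqrt_nat_ge (B + (2 * r)^-1 + 1).
have [m4 _ m4P] := x0 _ r1_gt0.
(* Beyond [m3] the real part of [1 / x m] is at least [m - B sqrt m], which exceeds [1 / (2 r)];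
   beyond [m4] the point lies in the disc where [f] is continuous. *)
pose m5 := maxn m2 (maxn m3 m4).
have r2V : 0 < (2 * r)^-1 by rewrite invr_gt0 mulr_gt0.
have good m : (m5 <= m)%N -> [/\ (m2 <= m)%N, repelling_petal r (x m) & ccont f (x m)].
  rewrite !geq_max => /and3P[mm2 mm3 mm4].
  have m_gt0 : (0 < m)%N by apply: leq_trans mm2.
  split=> //; last first.
    by apply/fU/Ur1; have := m4P m mm4; rewrite subr0.
  apply/(repelling_petalP _ r_gt0).
  have re : (2 * r)^-1 < complex.Re (x m)^-1.
    have := le_trans (cmod_ge_Re _) (xinv m mm2).
    have -> : complex.Re ((x m)^-1 - m%:R) = complex.Re (x m)^-1 - m%:R.
      rewrite -(rmorph_nat (real_complex R)).
      by case: (x m)^-1.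
    rewrite ler_norml => /andP[h _].
    have h' := mul_sqrt_lt_sub (ltW r2V) m_gt0 (m3P m mm3).
    apply: lt_le_trans h' _.
    by rewrite -(lerD2r (- m%:R)) addrAC subrr add0r.
  split=> //; apply: contraTneq re => ->; rewrite invr0 /= -leNgt; exact: ltW.
(* Limit of [w_(n-m) = f(w_(n-m-1)) + eps^2] along [G], by continuity of [f] at [x m.+1]. *)
have fx m : (m5 <= m)%N -> f (x m.+1) = x m.
  move=> mm; have [mm2 _ _] := good _ mm; have [m12 _ fc] := good m.+1 (leqW mm).
  have [h0 _ _] := xP _ mm2; have [h1 _ _] := xP _ m12.
  apply: (@clim_unique _ _ G _ (fun n => w n (n - m)%N)) h0.
  have e0 : clim G (fun n => eps n (n - m.+1)%N ^+ 2) 0.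
    apply: (clim_filter_le ooG); apply: clim_eps2.
    by apply: filterS (near_infty_gt m) => n mn; nlia.
  rewrite -[f _]addr0; apply: clim_near (climD (clim_comp fc h1) e0).
  apply: ooG; apply: filterS (near_infty_gt m) => n mn.
  by rewrite -w_step; congr (w n _); nlia.
have [_ phi_inj phi_S phi_asy] := phi_oP.
have phi_const m : (m5 <= m)%N -> phi_o (x m) + m%:R = phi_o (x m5) + m5%:R.
  elim: m => [|m IH]; first by rewrite leqn0 => /eqP ->.
  rewrite leq_eqVlt => /orP[/eqP <- //|mm].
  have [_ P1 _] := good _ mm; have [_ P0 _] := good m.+1 (leqW mm).
  by rewrite -IH // -(fx m mm) phi_S ?fx // -[m.+1%:R]natr1; ring.
pose zeta := xi + u.
(* The quantity [phi_o (x j) + j] does not depend on [j], so its limit is its value. Both Fatou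
   coordinates contribute [- (1 - a) ln j]; these cancel, and [B / sqrt j] now tends to 0. *)
have phi_x m : (m5 <= m)%N -> phi_o (x m) = zeta - m%:R.
  move=> mm; apply/eqP; rewrite eq_sym subr_eq eq_sym; apply/eqP.
  rewrite phi_const // -(phi_const m) //.
  have jpos : \forall j \near \oo, 0 < (j%:R : R).
    by apply: filterS (near_infty_gt 0) => j j0; rewrite ltr0n.
  have pet : \forall j \near \oo, repelling_petal r (x j).
    by exists m5 => // j jm; have [] := good j jm.
  have h1 : clim \oo (fun j => phi_o (x j) - (- (x j)^-1 + (1 - a) * cLog (x j))) 0.
    exact: (within_clim0 phi_asy x0 pet).
  have h2 : clim \oo (fun j => cLog (x j) + (ln (j%:R : R))%:C) 0 by exact: clim_cLog.
  have h3 : clim \oo (fun j => j%:R - (x j)^-1 - (- (iter j f w0)^-1 - j%:R)) u.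
    apply: clim_le (clim_sqrtV B) _; exists m2 => // j jm.
    by have [] := xP j jm.
  apply: (@clim_unique _ _ \oo _ (fun j => phi_o (x j) + j%:R)).
    apply: clim_near (clim_cst (phi_o (x m) + m%:R)).
    by exists m5 => // j jm; rewrite !phi_const.
  have -> : zeta = 0 + (1 - a) * 0 + u + xi by rewrite /zeta; ring.
  apply: clim_ext (climD (climD (climD h1 (climM (clim_cst (1 - a)) h2)) h3) xi_lim) => j.
  by ring.
have inv_x m : (m5 <= m)%N -> repelling_inverse r phi_o (zeta - m%:R) = x m.
  move=> mm; have [_ P _] := good m mm; apply: xget_unique.
    by split=> //; apply: phi_x.
  move=> y [yP phy]; apply: phi_inj; rewrite ?inE //.
  by rewrite phy phi_x.
(* The convention on [U] at [zeta] makes the [m7] iterates that lead out from [x m7] stay where [f]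
   is continuous. *)
have [m6 _ m6P] := phi_o_ext zeta.
pose m7 := maxn m5 m6.
have m75 : (m5 <= m7)%N by apply: leq_maxl.
have [_ def7] := m6P m7 (leq_maxr _ _).
rewrite inv_x // in def7.
have [m72 _ _] := good _ m75; have [w7 _ _] := xP _ m72.
have iter_x i : iter i f (x (m7 + i)%N) = x m7.
  elim: i => [|i IH]; first by rewrite addn0.
  rewrite addnS iterSr fx ?IH //.
  by apply: leq_trans m75 _; apply: leq_addr.
have -> : Lavaurs_map f r phi_i phi_o u w0 = iter m7 f (x m7).
  rewrite /Lavaurs_map /repelling_inverse_ext -/xi -/zeta.
  have zP : \forall m \near \oo,
      iter m7 f (x m7) = iter m f (repelling_inverse r phi_o (zeta - m%:R)).
    exists m7 => // m mm; have {}mm : (m7 <= m)%N := mm.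
    rewrite inv_x; last by apply: leq_trans mm.
    transitivity (iter m7 f (iter (m - m7) f (x m))).
      by have := iter_x (m - m7)%N; rewrite subnKC // => ->.
    by rewrite -iterD subnKC.
  apply: xget_unique => // y yP.
  have [m [<- ->]] : exists m,
     iter m7 f (x m7) = iter m f (repelling_inverse r phi_o (zeta - m%:R)) /\
     y = iter m f (repelling_inverse r phi_o (zeta - m%:R)).
    exact: (filter_ex (filterI zP yP)).
  by [].
(* The last [m7] steps start near [x m7] and follow its orbit under [f], which ends at the value of
   the Lavaurs map. *)
apply: clim_near (_ : clim G (fun n => w n (n - m7 + m7)%N) _).
  apply: ooG; apply: filterS (near_infty_gt m7) => n mn.
  by rewrite subnK // ltnW.
apply: (@clim_orbit _ _ G _ f (fun n k => w n (n - m7 + k)%N)).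
- by apply: clim_ext w7 => n; rewrite addn0.
- move=> k km; apply: (clim_filter_le ooG).
  apply: clim_ext (clim_eps2 (k := fun n => (n - m7 + k)%N) _) => [n|].
    by rewrite addnS w_step addrC addKr.
  by apply: filterS (near_infty_gt m7) => n mn; nlia.
- by move=> k km; apply/fU/def7.
Qed.

Lemma perturbed_orbit_Lavaurs :
  clim \oo (fun n => w n n) (Lavaurs_map f r phi_i phi_o u w0).
Proof. by apply: clim_ultra => G UG ooG; apply: ultra_Lavaurs. Qed.
End lavaurs.
End assembly.

Theorem corollary1p4 (R : realType) (U : set R[i]^o) (f : R[i]^o -> R[i]^o)
    (a : R[i]^o)
    (U_open : open U) (U_0 : U 0) (f_holo : holomorphic_on U f)
    (f_expansion : (fun w : R[i]^o => f w - (w + w ^+ 2 + a * w ^+ 3))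
        =O_ (0 : R[i]^o) (fun w : R[i]^o => w ^+ 4)) :
  \forall r \near (0 : R)^'+,
  forall phi_i phi_o : R[i]^o -> R[i]^o,
  attracting_Fatou_coordinate f a r phi_i ->
  repelling_Fatou_coordinate f a r phi_o ->
  repelling_inverse_extends U f r phi_o ->
  forall (d : measure_display) (T : measurableType d) (P : probability T R)
    (sigma : nat -> T -> R[i]^o) (u : R[i]^o)
    (alpha : R) (eps : nat -> nat -> T -> R[i]^o),
  (forall k, measurable_fun [set: T] (sigma k : T -> borelC R)) ->
  (exists M : R, forall k omega, `|sigma k omega| <= M%:C) ->
  {ae P, forall omega,
    (fun n : nat => n%:R^-1 * \sum_(0 <= k < n) sigma k omega) @ \oo --> u} ->
  0 < alpha < 1 ->
  (exists K : R, forall n k omega, (0 < n)%N -> (k < n)%N ->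
    `|eps k n omega
      - ((pi / n%:R)%:C + (pi / n%:R ^+ 2)%:C * sigma k omega)|
    <= (K / n%:R `^ (2 + alpha))%:C) ->
  forall w0 : R[i]^o, parabolic_basin U f r w0 ->
  {ae P, forall omega,
    (fun n : nat => perturbed_orbit f (fun k => eps k n omega) w0 n)
      @ \oo --> Lavaurs_map f r phi_i phi_o u w0}.
Proof.
pose N := @Normc.normc R.
have [r1 [K [r10 K0 Ur1 fE]]] : exists r1 K : R, [/\ 0 < r1, 0 <= K,
    forall w, N w < r1 -> U w &
    forall w, N w < r1 -> N (f w - (w + w ^+ 2 + a * w ^+ 3)) <= K * N w ^+ 4].
  have [k k0 fO] := (eqO_exP _ _ _).1 f_expansion.
  have nbU : nbhs (0 : R[i]^o) U by apply: open_nbhs_nbhs.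
  have [d /= d0 H] := (@nbhs_normP _ R[i]^o (0 : R[i]^o) _).1 (filterI fO nbU).
  move: d0; rewrite ltcE /= => /andP[/eqP dI d0].
  move: k0; rewrite ltcE /= => /andP[/eqP kI k0].
  have H' w : N w < complex.Re d ->
    (`|f w - (w + w ^+ 2 + a * w ^+ 3)| <= k * `|w ^+ 4|) /\ U w.
    move=> wd; apply: H; rewrite /= sub0r cmodE cmodN ltcE /= wd andbT.
    by apply/eqP; rewrite dI.
  exists (complex.Re d), (complex.Re k); split=> //; first exact: ltW.
    by move=> w /H'[].
  move=> w /H'[h _]; move: h; rewrite !cmodE cmodX.
  rewrite (_ : k = (complex.Re k)%:C); last by case: (k) kI => x y /= ->.
  by rewrite -rmorphM lecR.
have [C [r2 [C0 r20 r21 step]]] := fatou_step r10 K0 fE.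
(* The two bounds yield [2 * r <= r2] and [4 * C * r <= 1]; the 1 added to [C] avoids dividing by
   zero. *)
have rho0 : 0 < Num.min (r2 / 2) (4 * (C + 1))^-1.
  by rewrite lt_min divr_gt0 // invr_gt0; lra.
apply: filterS2 (nbhs_right_gt (0 : R)) (nbhs_right_lt rho0) => r r0.
rewrite lt_min => /andP[rr2 rC] phi_i phi_o phi_iP phi_oP phi_oE.
have {}rr2 : 2 * r <= r2 by lra.
have C4 : 4 * C * r <= 1.
  have C1 : 0 < 4 * (C + 1) by lra.
  by move: rC; rewrite -[X in _ < X]div1r ltr_pdivlMr //; nra.
move=> d T P sigma u alpha eps _ [M sM] mean /andP[a0 _] [K' epsP] w0 w0P.
(* Convergence is proved at every outcome where the means converge, so the exceptional set does not
   depend on [w0]. *)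
apply: filterS mean => omega /climP mean; apply/climP.
have sM' k : N (sigma k omega) <= M by have := sM k omega; rewrite cmodE lecR.
have epsP' n k : (0 < n)%N -> (k < n)%N ->
    N (eps k n omega - ((pi / n%:R)%:C + (pi / n%:R ^+ 2)%:C * sigma k omega))
    <= K' / n%:R `^ (2 + alpha).
  by move=> n0 kn; have := epsP n k omega n0 kn; rewrite cmodE lecR.
have [b [E [E0 b0 eps_mean eps_le]]] :=
  @eps_estimates R (sigma^~ omega) M K' alpha (fun n k => eps k n omega) sM' a0 epsP'.
apply: (@perturbed_orbit_Lavaurs R U f a r1 K C r2 r r10 K0 C0 r21 r0 rr2 C4 fE Ur1
   _ step phi_i phi_o phi_iP phi_oP phi_oE (sigma^~ omega) u M sM' mean
   (fun n k => eps k n omega) b E E0 b0 eps_mean eps_le w0 w0P).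
by move=> w Uw; apply/derivable_ccont/f_holo.
Qed.
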